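(* Let $\bar{\mathcal Q}$ and $\bar{\mathcal R}$ denote the results computed in floating-point arithmetic by the algorithm BCGSI+A-3S applied to $\mathcal X\in\mathbb R^{m\times ps}$ with intraorthogonalization routines $\mathrm{IO}_A$ and $\mathrm{IO}$. Assume that for all $X\in\mathbb R^{m\times s}$ with $\kappa(X)\le\kappa(\mathcal X)$, the following hold for the computed $[\bar Q,\bar R]=\mathrm{IO}_A(X)$: $$X+\Delta X=\bar Q\bar R,\quad \|\Delta X\|\le O(\varepsilon)\|X\|,\qquad \|I-\bar Q^T\bar Q\|\le O(\varepsilon)\,\kappa^{\alpha_A}(X),$$ and for the computed $[\bar Q,\bar R]=\mathrm{IO}(X)$ it holds that $$X+\Delta X=\bar Q\bar R,\quad \|\Delta X\|\le O(\varepsilon)\|X\|,\qquad \|I-\bar Q^T\bar Q\|\le O(\varepsilon)\,\kappa^{\alpha}(X).$$ If $\alpha_A\le\alpha$ and $O(\varepsilon)\,\kappa^{\theta}(\mathcal X)\le\frac12$ with $\theta:=\max(\alpha+1,2)$, then $$\mathcal X+\Delta\mathcal X=\bar{\mathcal Q}\bar{\mathcal R},\quad\|\Delta\mathcal X\|\le O(\varepsilon)\|\mathcal X\|,$$ and $$\|I-\bar{\mathcal Q}^T\bar{\mathcal Q}\|\le O(\varepsilon)\,\bigl(\kappa(\mathcal X)\bigr)^{\max\{\alpha,1\}}.$$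
   Context: Conventions. $m,s,p$ are positive integers with $m\ge ps$; $\mathcal X=[X_1\ X_2\ \cdots\ X_p]\in\mathbb R^{m\times ps}$ with block vectors $X_k\in\mathbb R^{m\times s}$. $\|\cdot\|$ is the induced 2-norm and $\kappa(\cdot)$ is the 2-norm condition number (ratio of largest to smallest singular value); $\kappa^{\alpha}(X)=(\kappa(X))^\alpha$, with nonnegative real exponents. Computations are carried out in floating-point arithmetic (standard model) with unit roundoff $\varepsilon$, and bars denote computed quantities. $O(\varepsilon)$ denotes a quantity bounded by $c\,\varepsilon$, where $c$ depends only on the dimensions $m,s,p$ (and the fixed exponents) and may differ at each occurrence; a hypothesis involving $O(\varepsilon)$ means that it holds with a suitable (sufficiently large) such constant. An intraorthogonalization routine $\mathrm{IO}$ takes $X\in\mathbb R^{m\times s}$ and returns $[Q,R]$, where in exact arithmetic $X=QR$, $Q\in\mathbb R^{m\times s}$, $Q^TQ=I$, and $R\in\mathbb R^{s\times s}$ is upper triangular. Notation. $\mathcal Q_k=[Q_1\ \cdots\ Q_k]$; $\mathcal R=(R_{ij})$, $\mathcal S=(S_{ij})$, $\mathcal Y=(Y_{ij})$ have $s\times s$ blocks; a subscript $1{:}k-1,k$ denotes the block column with block rows $1,\dots,k-1$ and block column $k$. Algorithm BCGSI+A-3S($\mathcal X,\mathrm{IO}_A,\mathrm{IO}$): $[Q_1,R_{11}]=\mathrm{IO}_A(X_1)$. For $k=2,\dots,p$: $\mathcal S_{1:k-1,k}=\mathcal Q_{k-1}^TX_k$; $V_k=X_k-\mathcal Q_{k-1}\mathcal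 S_{1:k-1,k}$; $\mathcal Y_{1:k-1,k}=\mathcal Q_{k-1}^TV_k$; $[Q_k,Y_{kk}]=\mathrm{IO}(V_k-\mathcal Q_{k-1}\mathcal Y_{1:k-1,k})$; $\mathcal R_{1:k-1,k}=\mathcal S_{1:k-1,k}+\mathcal Y_{1:k-1,k}$; $R_{kk}=Y_{kk}$. Return $\mathcal Q=[Q_1,\dots,Q_p]$ and $\mathcal R=(R_{ij})$.
   Formalization: The accuracy of IO (not IO_A) is assumed for all X with κ(X) ≤ (1+O(ε)κ(𝒳))κ(𝒳) instead of κ(X) ≤ κ(𝒳), because rounding can push the condition number of the block passed to IO slightly above κ(𝒳), where the literal hypothesis says nothing and the claim fails. *)

(* Defs.v *)
From HB Require Import structures.
From mathcomp Require Import all_boot all_order all_algebra.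
From mathcomp Require Import all_classical all_reals all_analysis.

Set Implicit Arguments.
Unset Strict Implicit.
Unset Printing Implicit Defensive.

Import Order.TTheory GRing.Theory Num.Theory.
Local Open Scope classical_set_scope.
Local Open Scope ring_scope.

Section Norms.
Context {R : realType}.

Definition vnorm2 (n : nat) (x : 'cV[R]_n) : R :=
  Num.sqrt (\sum_(i < n) x i 0 ^+ 2).

Definition mxnorm2 (m n : nat) (A : 'M[R]_(m, n)) : R :=
  sup [set vnorm2 (A *m x) | x in [set x : 'cV[R]_n | vnorm2 x = 1]].

(* These are all n singular values when n <= m, the only case used below; for
   m < n the set would also contain a spurious 0. *)
Definition singular_values (m n : nat) (A : 'M[R]_(m, n)) : set R :=
  [set t | 0 <= t /\ eigenvalue (A^T *m A) (t ^+ 2)].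

(* +oo exactly when the columns of A are linearly dependent. *)
Definition cond2 (m n : nat) (A : 'M[R]_(m, n)) : \bar R :=
  if inf (singular_values A) == 0 then +oo%E
  else (sup (singular_values A) / inf (singular_values A))%:E.

End Norms.

(* Standard model of floating-point arithmetic with unit roundoff u, given as
   relations: the last argument is an admissible computed value. *)
Section StandardModel.
Context {R : realType}.
Variable u : R.

Definition fl_rnd (x y : R) : Prop := exists2 d, `|d| <= u & y = x * (1 + d).

(* Summation of a nonempty list, in any order and with any bracketing. *)
Inductive fl_sum : seq R -> R -> Prop :=
| fl_sum1 x : fl_sum [:: x] x
| fl_sumD t t1 t2 y1 y2 y : perm_eq t (t1 ++ t2) ->
    fl_sum t1 y1 -> fl_sum t2 y2 -> fl_rnd (y1 + y2) y -> fl_sum t y.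

Definition fl_addmx (m n : nat) (A B C : 'M[R]_(m, n)) : Prop :=
  forall i j, fl_rnd (A i j + B i j) (C i j).

Definition fl_submx (m n : nat) (A B C : 'M[R]_(m, n)) : Prop :=
  forall i j, fl_rnd (A i j - B i j) (C i j).

Definition fl_mulmx (m n q : nat) (A : 'M[R]_(m, n)) (B : 'M[R]_(n, q))
    (C : 'M[R]_(m, q)) : Prop :=
  forall i k, exists2 P : 'I_n -> R,
    forall j, fl_rnd (A i j * B j k) (P j) & fl_sum (codom P) (C i k).

End StandardModel.

(* An intraorthogonalization routine: its result in exact arithmetic, and the
   result it computes in floating-point arithmetic, about which nothing is
   known besides what a theorem assumes (see [io_accurate]). *)
Record io_routine (R : realType) (m s : nat) := IORoutine {
  io_exact : 'M[R]_(m, s) -> 'M[R]_(m, s) * 'M[R]_s;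
  io_exactP : forall X, let: (Q, T) := io_exact X in
    [/\ X = Q *m T, Q^T *m Q = 1%:M &
        forall i j : 'I_s, (j < i)%N -> T i j = 0];
  io_fl : 'M[R]_(m, s) -> 'M[R]_(m, s) * 'M[R]_s
}.

(* K bounds the condition numbers for which accuracy is required. Rounding can
   make the condition number of the block W that BCGSI+A-3S passes to its
   second routine exceed that of the input matrix A, by a relative O(u) cond2 A;
   so K = cond2 A is too small for that routine (with A orthogonal, it could
   return anything on W), whereas K = (1 + C u cond2 A) cond2 A is enough. *)
Definition io_accurate (R : realType) (m s : nat) (u c1 c2 alpha : R)
    (K : \bar R) (IO : io_routine R m s) : Prop :=
  forall X : 'M[R]_(m, s), (cond2 X <= K)%E ->
    let: (Q, T) := io_fl IO X in
    (exists2 DX : 'M[R]_(m, s),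
       X + DX = Q *m T & mxnorm2 DX <= c1 * u * mxnorm2 X) /\
    ((mxnorm2 (1%:M - Q^T *m Q))%:E <= (c2 * u)%:E * cond2 X `^ alpha)%E.

Section Algorithm.
Context {R : realType} {m s p : nat}.

Definition before (k : 'I_p) (j : 'I_k) : 'I_p :=
  widen_ord (ltnW (ltn_ord k)) j.

(* [bcgsi_a3s u IOA IO X Q T]: Q and T are possible outputs of BCGSI+A-3S on X
   in arithmetic with unit roundoff u. Blocks are numbered from 0, and Qp is
   the concatenation of the blocks of Q preceding block k. *)
Definition bcgsi_a3s (u : R) (IOA IO : io_routine R m s)
    (X Q : 'M[R]_(m, \sum_(k < p) s))
    (T : 'M[R]_(\sum_(k < p) s, \sum_(k < p) s)) : Prop :=
  [/\ forall k : 'I_p, k = 0%N :> nat ->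
        io_fl IOA (submxrow X k) = (submxrow Q k, submxblock T k k),
      forall k : 'I_p, (0 < k)%N ->
        let Qp := \mxrow_(j < k) submxrow Q (before j) in
        exists S Y : 'M[R]_(\sum_(j < k) s, s),
        exists QS V QY W : 'M[R]_(m, s),
        [/\ fl_mulmx u Qp^T (submxrow X k) S,
            fl_mulmx u Qp S QS /\ fl_submx u (submxrow X k) QS V,
            fl_mulmx u Qp^T V Y,
            fl_mulmx u Qp Y QY /\ fl_submx u V QY W &
            io_fl IO W = (submxrow Q k, submxblock T k k) /\
            fl_addmx u S Y (\mxcol_(i < k) submxblock T (before i) k)] &
      forall i j : 'I_p, (j < i)%N -> submxblock T i j = 0].

End Algorithm.

(* Main.v *)
Require Import Defs.
From HB Require Import structures.
From mathcomp Require Import all_boot all_order all_algebra.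
From mathcomp Require Import all_classical all_reals all_analysis.
From mathcomp Require Import ring lra.

(* Write Q, T for the computed factors of X, and restrict to the blocks before
   block k, where Q T = X + DX with |DX| <= O(u) |X| and |Q^T Q - I| <= delta,
   delta = O(u) kappa^max(alpha, 1), so that delta kappa <= 1.  Two passes give
   W = (I - Q Q^T)^2 X_k + O(u) |X_k| with |I - Q Q^T| <= 1, whence
   |W| <= (1 + O(u)) |X|.  Up to rounding errors O(u) |X|, W also equals X Z for
   a Z whose k-th block is I, so its smallest gain |W x| / |x| is at least that
   of X times 1 - O(u) kappa.  Thus cond W is in the range where IO is accurate,
   and T_kk has an inverse bounded by O(1) / sigma_min(X).  Since
   Q^T W = (I - Q^T Q)^2 Q^T X_k + O(u) |X|, this gives
   |Q^T Q_k| <= O(delta^2 + u) kappa = O(delta + u kappa), and induction on k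
   concludes. *)

Set Implicit Arguments.
Unset Strict Implicit.
Unset Printing Implicit Defensive.

Import Order.TTheory GRing.Theory Num.Theory.
Local Open Scope classical_set_scope.
Local Open Scope ring_scope.

(** The obstacle is the narrow range in which the second routine is known to be accurate: condition
    numbers up to [(1 + C u kappa) kappa]. When [alpha > 1], delta may be much larger than
    [u kappa], so no factor [1 + O(delta)] may enter the estimate of cond W. The norm escapes it
    because [|I - Q Q^T| <= 1] holds exactly as soon as [|Q^T Q - I| <= 1]. The gain escapes it
    because the comparison of W with [X Z] loses only residuals of the factorization, never a defect
    of orthogonality. With [beta = kappa^max(alpha, 1)] one has [kappa^theta = kappa beta]. The
    exponent theta is thus what makes [delta kappa] bounded, so that one of the two factors delta
    won by the two passes pays for the division by sigma_min. Constants grow from block to block,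
    and the same C occurs in the smallness assumption and in the accuracy range. The invariant is
    therefore proved for every [C'] above a threshold chosen before u and X. Gains replace sigma_min
    throughout, since they survive perturbation; eigenvalues serve only to translate them into
    [cond2]. *)

Section EuclideanNorm.
Variable R : realType.
Implicit Types n m q : nat.

(** * Euclidean norm through the inner product *)

Definition dotv n (x y : 'cV[R]_n) : R := (x^T *m y) 0 0.

Lemma dotvC n (x y : 'cV[R]_n) : dotv x y = dotv y x.
Proof.
by rewrite /dotv !mxE; apply: eq_bigr => i _; rewrite !mxE mulrC.
Qed.

Lemma dotvDl n (x y z : 'cV[R]_n) : dotv (x + y) z = dotv x z + dotv y z.
Proof. by rewrite /dotv linearD /= mulmxDl mxE. Qed.

Lemma dotvDr n (x y z : 'cV[R]_n) : dotv x (y + z) = dotv x y + dotv x z.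
Proof. by rewrite dotvC dotvDl !(dotvC x). Qed.

Lemma dotvZl n a (x y : 'cV[R]_n) : dotv (a *: x) y = a * dotv x y.
Proof. by rewrite /dotv linearZ /= -scalemxAl mxE. Qed.

Lemma dotvZr n a (x y : 'cV[R]_n) : dotv x (a *: y) = a * dotv x y.
Proof. by rewrite dotvC dotvZl dotvC. Qed.

Lemma dotvNr n (x y : 'cV[R]_n) : dotv x (- y) = - dotv x y.
Proof. by rewrite -scaleN1r dotvZr mulN1r. Qed.

Lemma dotv_mulmxl m n (A : 'M[R]_(m, n)) x y :
  dotv (A *m x) y = dotv x (A^T *m y).
Proof. by rewrite /dotv trmx_mul mulmxA. Qed.

Lemma dotvvE n (x : 'cV[R]_n) : dotv x x = \sum_i x i 0 ^+ 2.
Proof. by rewrite /dotv mxE; apply: eq_bigr => i _; rewrite mxE expr2. Qed.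

Lemma dotvv_ge0 n (x : 'cV[R]_n) : 0 <= dotv x x.
Proof. by rewrite dotvvE sumr_ge0// => i _; exact: sqr_ge0. Qed.

Lemma vnorm2_ge0 n (x : 'cV[R]_n) : 0 <= vnorm2 x.
Proof. exact: sqrtr_ge0. Qed.

Lemma sqr_vnorm2 n (x : 'cV[R]_n) : vnorm2 x ^+ 2 = dotv x x.
Proof. by rewrite /vnorm2 -dotvvE sqr_sqrtr// dotvv_ge0. Qed.

Lemma vnorm2_eq0 n (x : 'cV[R]_n) : (vnorm2 x == 0) = (x == 0).
Proof.
apply/idP/eqP => [/eqP x0|->]; last first.
  by rewrite -sqrf_eq0 sqr_vnorm2 -(scale0r 0) dotvZl mul0r.
have: dotv x x = 0 by rewrite -sqr_vnorm2 x0 expr0n.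
rewrite dotvvE => /eqP; rewrite psumr_eq0 => [/allP x00|i _];
  last exact: sqr_ge0.
apply/matrixP => i j; rewrite mxE ord1; apply/eqP.
by rewrite -sqrf_eq0; apply: (implyP (x00 i _)); rewrite ?mem_index_enum.
Qed.

Lemma vnorm2_0 n : vnorm2 (0 : 'cV[R]_n) = 0.
Proof. by apply/eqP; rewrite vnorm2_eq0. Qed.

Lemma vnorm2_gt0 n (x : 'cV[R]_n) : (0 < vnorm2 x) = (x != 0).
Proof. by rewrite lt_neqAle vnorm2_ge0 andbT eq_sym vnorm2_eq0. Qed.

Lemma le_vnorm2 n m (x : 'cV[R]_n) (y : 'cV[R]_m) a : 0 <= a ->
  (vnorm2 x <= a * vnorm2 y) = (dotv x x <= a ^+ 2 * dotv y y).
Proof.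
move=> a0; rewrite -(@ler_pXn2r _ 2)// ?nnegrE ?mulr_ge0 ?vnorm2_ge0//.
by rewrite exprMn !sqr_vnorm2.
Qed.

Lemma ge_vnorm2 n m (x : 'cV[R]_n) (y : 'cV[R]_m) a : 0 <= a ->
  (a * vnorm2 y <= vnorm2 x) = (a ^+ 2 * dotv y y <= dotv x x).
Proof.
move=> a0; rewrite -(@ler_pXn2r _ 2)// ?nnegrE ?mulr_ge0 ?vnorm2_ge0//.
by rewrite exprMn !sqr_vnorm2.
Qed.

(** For [c > 0], evaluate at the minimizer [- b / c]. For [c = 0] the expression is affine in [t],
    and if [b] is nonzero the chosen [t] gives it the value -1. *)
Lemma quadratic_ge0_discr (a b c : R) : 0 <= c ->
  (forall t, 0 <= a + t * b *+ 2 + t ^+ 2 * c) -> b ^+ 2 <= a * c.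
Proof.
rewrite le_eqVlt => /orP[/eqP <-|c0] H.
  case: (eqVneq b 0) => [->|b0]; first by rewrite expr0n mulr0.
  have := H (- (a + 1) / (b *+ 2)).
  have -> : a + - (a + 1) / (b *+ 2) * b *+ 2
    + (- (a + 1) / (b *+ 2)) ^+ 2 * 0 = -1 by field; rewrite ?b0.
  by rewrite ler0N1.
have := H (- b / c).
have -> : a + - b / c * b *+ 2 + (- b / c) ^+ 2 * c = (a * c - b ^+ 2) / c.
  by field; rewrite gt_eqF.
by rewrite ler_pdivlMr// mul0r subr_ge0.
Qed.

(** Semidefinite forms are allowed because the eigenvector argument applies this to [M - mu I];
    [B = 1] gives the usual inequality. *)
Lemma psd_Cauchy_Schwarz n (B : 'M[R]_n) (x y : 'cV[R]_n) : B^T = B ->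
  (forall z, 0 <= dotv z (B *m z)) ->
  dotv x (B *m y) ^+ 2 <= dotv x (B *m x) * dotv y (B *m y).
Proof.
move=> Bsym Bpos; apply: quadratic_ge0_discr => // t.
have := Bpos (x + t *: y).
rewrite mulmxDr -scalemxAr !(dotvDl, dotvDr, dotvZl, dotvZr).
have -> : dotv y (B *m x) = dotv x (B *m y) by rewrite dotvC dotv_mulmxl Bsym.
by congr (0 <= _); ring.
Qed.

Lemma Cauchy_Schwarz n (x y : 'cV[R]_n) : dotv x y <= vnorm2 x * vnorm2 y.
Proof.
have := @psd_Cauchy_Schwarz n 1%:M x y (trmx1 _ _).
rewrite !mul1mx => /(_ (fun z => _)) H.
case: (ltrP (dotv x y) 0) => [/ltW/le_trans->//|xy0].
  by rewrite mulr_ge0 ?vnorm2_ge0.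
rewrite -(@ler_pXn2r _ 2)// ?nnegrE ?mulr_ge0 ?vnorm2_ge0//.
by rewrite exprMn !sqr_vnorm2; apply: H => z; rewrite mul1mx dotvv_ge0.
Qed.

Lemma ler_vnorm2D n (x y : 'cV[R]_n) : vnorm2 (x + y) <= vnorm2 x + vnorm2 y.
Proof.
rewrite -(@ler_pXn2r _ 2)// ?nnegrE ?addr_ge0 ?vnorm2_ge0//.
rewrite sqrrD !sqr_vnorm2 !(dotvDl, dotvDr) (dotvC y x).
by have := Cauchy_Schwarz x y; lra.
Qed.

Lemma vnorm2Z n a (x : 'cV[R]_n) : vnorm2 (a *: x) = `|a| * vnorm2 x.
Proof.
apply: (@pexpIrn _ 2) => //; rewrite ?nnegrE ?mulr_ge0 ?vnorm2_ge0//.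
by rewrite exprMn !sqr_vnorm2 dotvZl dotvZr mulrA real_normK ?num_real// expr2.
Qed.

Lemma vnorm2N n (x : 'cV[R]_n) : vnorm2 (- x) = vnorm2 x.
Proof. by rewrite -scaleN1r vnorm2Z normrN1 mul1r. Qed.

Lemma ler_vnorm2B n (x y : 'cV[R]_n) : vnorm2 (x - y) <= vnorm2 x + vnorm2 y.
Proof. by rewrite (le_trans (ler_vnorm2D _ _))// vnorm2N. Qed.

Lemma lerB_vnorm2D n (x y : 'cV[R]_n) : vnorm2 x - vnorm2 y <= vnorm2 (x + y).
Proof. by rewrite lerBlDr; have := ler_vnorm2B (x + y) y; rewrite addrK. Qed.

Lemma vnorm2_normalize n (x : 'cV[R]_n) : x != 0 ->
  vnorm2 ((vnorm2 x)^-1 *: x) = 1.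
Proof.
rewrite -vnorm2_gt0 => x0.
by rewrite vnorm2Z ger0_norm ?invr_ge0 ?ltW// mulVf// gt_eqF.
Qed.

Lemma vnorm2_entry n (x : 'cV[R]_n) i : `|x i 0| <= vnorm2 x.
Proof.
rewrite -(@ler_pXn2r _ 2)// ?nnegrE ?vnorm2_ge0// sqr_vnorm2 dotvvE.
by rewrite real_normK ?num_real// (bigD1 i)//= lerDl sumr_ge0// => j _;
  exact: sqr_ge0.
Qed.

Lemma vnorm2_sum n (x : 'cV[R]_n) : vnorm2 x <= \sum_i `|x i 0|.
Proof.
rewrite -(@ler_pXn2r _ 2)// ?nnegrE ?sumr_ge0 ?vnorm2_ge0//.
rewrite sqr_vnorm2 dotvvE expr2 mulr_suml; apply: ler_sum => i _.
rewrite -[_ ^+ 2]real_normK ?num_real// expr2 ler_wpM2l//.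
by rewrite (bigD1 i)//= lerDl sumr_ge0.
Qed.

Lemma exists_unit_vector n : (0 < n)%N -> exists x : 'cV[R]_n, vnorm2 x = 1.
Proof.
case: n => // n _.
have c0 : const_mx 1 != 0 :> 'cV[R]_n.+1.
  by apply/eqP => /matrixP/(_ 0 0)/eqP; rewrite !mxE oner_eq0.
by eexists; exact: vnorm2_normalize c0.
Qed.

End EuclideanNorm.

(** * Operator norm, transposes, and matrices with nearly orthonormal columns *)

Section SpectralNorm.
Variable R : realType.
Implicit Types n m q : nat.

Local Notation unit_sphere n := [set x : 'cV[R]_n | vnorm2 x = 1].

(** A crude bound, whose only purpose is that the supremum defining [mxnorm2] is taken over a
    bounded set. *)
Lemma mulmx_bounded m n (A : 'M[R]_(m, n)) :
  exists2 K, 0 <= K & forall x, vnorm2 (A *m x) <= K * vnorm2 x.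
Proof.
exists (\sum_i \sum_j `|A i j|).
  by apply: sumr_ge0 => i _; apply: sumr_ge0.
move=> x; apply: (le_trans (vnorm2_sum _)).
rewrite mulr_suml; apply: ler_sum => i _; rewrite mxE mulr_suml.
apply: (le_trans (ler_norm_sum _ _ _)); apply: ler_sum => j _.
by rewrite normrM ler_wpM2l// vnorm2_entry.
Qed.

Lemma mxnorm2_ge0 m n (A : 'M[R]_(m, n)) : 0 <= mxnorm2 A.
Proof.
rewrite /mxnorm2; set E := (X in sup X).
(* For [n = 0] there is no unit vector, and the supremum of the empty set is 0 by convention. *)
have [->|/set0P[t Et]] := eqVneq E set0; first by rewrite sup0.
have [K _ KP] := mulmx_bounded A.
apply: (@le_trans _ _ t); first by case: Et => x _ <-; exact: vnorm2_ge0.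
apply: ub_le_sup => //; exists K => _ [y /= y1 <-].
by rewrite (le_trans (KP y))// y1 mulr1.
Qed.

Lemma ler_vnorm2_mulmx m n (A : 'M[R]_(m, n)) x :
  vnorm2 (A *m x) <= mxnorm2 A * vnorm2 x.
Proof.
have [->|x0] := eqVneq x 0; first by rewrite mulmx0 !vnorm2_0 mulr0.
have nx0 : 0 < vnorm2 x by rewrite vnorm2_gt0.
rewrite -ler_pdivrMr// mulrC.
have -> : (vnorm2 x)^-1 * vnorm2 (A *m x)
    = vnorm2 (A *m ((vnorm2 x)^-1 *: x)).
  by rewrite -scalemxAr vnorm2Z ger0_norm ?invr_ge0// ltW.
apply: ub_le_sup; last by exists ((vnorm2 x)^-1 *: x) => //;
  exact: vnorm2_normalize.
have [K _ KP] := mulmx_bounded A.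
by exists K => _ [y /= y1 <-]; rewrite (le_trans (KP y))// y1 mulr1.
Qed.

Lemma mxnorm2_le m n (A : 'M[R]_(m, n)) a : 0 <= a ->
  (forall x, vnorm2 (A *m x) <= a * vnorm2 x) -> mxnorm2 A <= a.
Proof.
move=> a0 H; rewrite /mxnorm2.
set E := (X in sup X).
have [->|/set0P E0] := eqVneq E set0; first by rewrite sup0.
by apply: ge_sup => // _ [y /= y1 <-]; rewrite (le_trans (H y))// y1 mulr1.
Qed.

Lemma mxnorm2_0 m n : mxnorm2 (0 : 'M[R]_(m, n)) = 0.
Proof.
apply/eqP; rewrite eq_le mxnorm2_ge0 andbT; apply: mxnorm2_le => // x.
by rewrite mul0mx vnorm2_0 mul0r.
Qed.

Lemma ler_mxnorm2D m n (A B : 'M[R]_(m, n)) :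
  mxnorm2 (A + B) <= mxnorm2 A + mxnorm2 B.
Proof.
apply: mxnorm2_le => [|x]; first by rewrite addr_ge0 ?mxnorm2_ge0.
rewrite mulmxDl (le_trans (ler_vnorm2D _ _))// mulrDl.
by apply: lerD; exact: ler_vnorm2_mulmx.
Qed.

Lemma mxnorm2N m n (A : 'M[R]_(m, n)) : mxnorm2 (- A) = mxnorm2 A.
Proof.
have H (B : 'M[R]_(m, n)) : mxnorm2 (- B) <= mxnorm2 B.
  apply: mxnorm2_le => [|x]; first exact: mxnorm2_ge0.
  by rewrite mulNmx vnorm2N ler_vnorm2_mulmx.
by apply/eqP; rewrite eq_le H -{1}(opprK A) H.
Qed.

Lemma mxnorm2_subC m n (A B : 'M[R]_(m, n)) : mxnorm2 (A - B) = mxnorm2 (B - A).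
Proof. by rewrite -mxnorm2N opprB. Qed.

Lemma ler_mxnorm2B m n (A B : 'M[R]_(m, n)) :
  mxnorm2 (A - B) <= mxnorm2 A + mxnorm2 B.
Proof. by rewrite (le_trans (ler_mxnorm2D _ _))// mxnorm2N. Qed.

Lemma ler_mxnorm2M m n q (A : 'M[R]_(m, n)) (B : 'M[R]_(n, q)) :
  mxnorm2 (A *m B) <= mxnorm2 A * mxnorm2 B.
Proof.
apply: mxnorm2_le => [|x]; first by rewrite mulr_ge0 ?mxnorm2_ge0.
rewrite -mulmxA (le_trans (ler_vnorm2_mulmx _ _))// -mulrA.
by rewrite ler_wpM2l ?mxnorm2_ge0// ler_vnorm2_mulmx.
Qed.

Lemma ler_mxnorm2M_bound m n q (A : 'M[R]_(m, n)) (B : 'M[R]_(n, q)) a b :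
  mxnorm2 A <= a -> mxnorm2 B <= b -> mxnorm2 (A *m B) <= a * b.
Proof.
move=> Aa Bb; rewrite (le_trans (ler_mxnorm2M _ _))//.
by rewrite ler_pM ?mxnorm2_ge0.
Qed.

(** By Cauchy-Schwarz, [|B^T x|^2 = x . B (B^T x) <= |x| |B| |B^T x|]; cancel one factor. *)
Lemma mxnorm2_tr m n (A : 'M[R]_(m, n)) : mxnorm2 A^T = mxnorm2 A.
Proof.
have H i j (B : 'M[R]_(i, j)) : mxnorm2 B^T <= mxnorm2 B.
  apply: mxnorm2_le => [|x]; first exact: mxnorm2_ge0.
  have [->|y0] := eqVneq (B^T *m x) 0.
    by rewrite vnorm2_0 mulr_ge0 ?vnorm2_ge0 ?mxnorm2_ge0.
  rewrite -vnorm2_gt0 in y0; rewrite -(ler_pM2r y0) -expr2 sqr_vnorm2.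
  rewrite dotv_mulmxl trmxK (le_trans (Cauchy_Schwarz _ _))//.
  rewrite mulrAC [leRHS]mulrC ler_wpM2l ?vnorm2_ge0//.
  exact: ler_vnorm2_mulmx.
by apply/eqP; rewrite eq_le H -{1}(trmxK A) H.
Qed.

Lemma mxnorm2_entry m n (A : 'M[R]_(m, n)) i j : `|A i j| <= mxnorm2 A.
Proof.
have -> : A i j = (A *m delta_mx j 0 : 'cV_m) i 0 by rewrite -colE mxE.
apply: (le_trans (vnorm2_entry _ _)); apply: (le_trans (ler_vnorm2_mulmx _ _)).
rewrite ler_piMr ?mxnorm2_ge0//.
suff -> : vnorm2 (delta_mx j 0 : 'cV[R]_n) = 1 by [].
apply: (@pexpIrn _ 2) => //; rewrite ?nnegrE ?vnorm2_ge0//.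
rewrite sqr_vnorm2 dotvvE (bigD1 j)//= big1 => [|k kj]; rewrite mxE.
  by rewrite !eqxx addr0.
by rewrite (negbTE kj) expr0n.
Qed.

Lemma mxnorm2_le_entries m n (A : 'M[R]_(m, n)) e :
  (forall i j, `|A i j| <= e) -> mxnorm2 A <= (m * n)%:R * `|e|.
Proof.
move=> H; apply: mxnorm2_le => [|x]; first by rewrite mulr_ge0.
apply: (le_trans (vnorm2_sum _)).
have -> : (m * n)%:R * `|e| * vnorm2 x
    = \sum_(i < m) \sum_(j < n) (`|e| * vnorm2 x).
  rewrite (eq_bigr (fun=> n%:R * (`|e| * vnorm2 x))) => [|i _]; last first.
    by rewrite sumr_const card_ord mulr_natl.
  by rewrite sumr_const card_ord natrM -mulr_natl; ring.
apply: ler_sum => i _; rewrite mxE (le_trans (ler_norm_sum _ _ _))//.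
apply: ler_sum => j _; rewrite normrM ler_pM ?vnorm2_entry//.
exact: le_trans (H i j) (ler_norm _).
Qed.

Lemma mxnorm2_isometry m n (F : 'M[R]_(m, n)) : F^T *m F = 1%:M -> mxnorm2 F <=
  1.
Proof.
move=> F1; apply: mxnorm2_le => // x.
by rewrite le_vnorm2// expr1n mul1r dotv_mulmxl mulmxA F1 mul1mx.
Qed.

Lemma mxnorm2_sqr_le_gram m n (Q : 'M[R]_(m, n)) d :
  mxnorm2 (Q^T *m Q - 1%:M) <= d ->
  forall x, vnorm2 (Q *m x) ^+ 2 <= (1 + d) * vnorm2 x ^+ 2.
Proof.
move=> Hd x; rewrite !sqr_vnorm2 dotv_mulmxl mulmxA.
have -> : Q^T *m Q = (Q^T *m Q - 1%:M) + 1%:M by rewrite subrK.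
rewrite mulmxDl mul1mx dotvDr addrC mulrDl mul1r lerD2l.
rewrite (le_trans (Cauchy_Schwarz _ _))// -sqr_vnorm2 expr2 mulrCA.
rewrite ler_wpM2l ?vnorm2_ge0// (le_trans (ler_vnorm2_mulmx _ _))//.
by rewrite ler_wpM2r ?vnorm2_ge0.
Qed.

Lemma mxnorm2_le_gram m n (Q : 'M[R]_(m, n)) :
  mxnorm2 (Q^T *m Q - 1%:M) <= 1 -> mxnorm2 Q <= 2.
Proof.
move=> H; apply: mxnorm2_le => [//|x].
rewrite le_vnorm2// -!sqr_vnorm2 (le_trans (mxnorm2_sqr_le_gram H _))//.
by rewrite ler_wpM2r ?sqr_ge0//; lra.
Qed.

(* |y - Q Q^T y|^2 = |y|^2 - 2 |Q^T y|^2 + |Q Q^T y|^2 and |Q|^2 <= 2 *)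
Lemma mxnorm2_project m n (Q : 'M[R]_(m, n)) :
  mxnorm2 (Q^T *m Q - 1%:M) <= 1 -> mxnorm2 (1%:M - Q *m Q^T) <= 1.
Proof.
move=> H; apply: mxnorm2_le => // y; rewrite le_vnorm2// expr1n mul1r.
rewrite mulmxBl mul1mx -mulmxA; set x := Q^T *m y.
have := mxnorm2_sqr_le_gram H x; rewrite !sqr_vnorm2 => Hx.
rewrite !(dotvDl, dotvDr, dotvNr) !(dotvC (- _)) !dotvNr (dotvC y).
have -> : dotv (Q *m x) y = dotv x x by rewrite dotv_mulmxl.
by lra.
Qed.

(** That the factor is exactly 1 matters: a factor [1 + O(delta)] could push the block passed to the
    second routine out of its accuracy range. *)
Lemma sub_mulmx_tr_project m n q (Q : 'M[R]_(m, n)) (X : 'M[R]_(m, q)) :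
  mxnorm2 (Q^T *m Q - 1%:M) <= 1 -> mxnorm2 (X - Q *m (Q^T *m X)) <= mxnorm2 X.
Proof.
move=> H; rewrite mulmxA -{1}(mul1mx X) -mulmxBl.
by rewrite -[leRHS]mul1r ler_mxnorm2M_bound// mxnorm2_project.
Qed.

End SpectralNorm.

(** * Singular values and condition number as extremal gains *)

Section SingularValues.
Variable R : realType.
Implicit Types n m q : nat.

(* If M - mu I is invertible, Cauchy-Schwarz for its quadratic form gives a gap
   |x|^2 <= |(M - mu I)^-1| (x . (M - mu I) x), which contradicts [tight]. *)
Lemma tight_lower_bound_eigenvector n (M : 'M[R]_n) mu : M^T = M ->
  (forall x, mu * dotv x x <= dotv x (M *m x)) ->
  (forall c, 0 < c -> exists x, dotv x (M *m x) < (mu + c) * dotv x x) ->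
  exists2 x : 'cV_n, x != 0 & M *m x = mu *: x.
Proof.
move=> Msym lower tight; pose B := M - mu%:M.
have Bsym : B^T = B by rewrite /B linearB /= Msym tr_scalar_mx.
have BE x : dotv x (B *m x) = dotv x (M *m x) - mu * dotv x x.
  by rewrite /B mulmxBl mul_scalar_mx dotvDr dotvNr dotvZr.
have Bpos x : 0 <= dotv x (B *m x) by rewrite BE subr_ge0.
have [Bunit|Bsing] := boolP (B \in unitmx).
  pose K := mxnorm2 (invmx B) + 1.
  have K0 : 0 < K by rewrite ltr_wpDl ?mxnorm2_ge0.
  have [|x] := tight K^-1; first by rewrite invr_gt0.
  rewrite ltNge => /negP[]; rewrite mulrDl -lerBrDl -BE.
  rewrite ler_pdivrMl//.
  have [->|x0] := eqVneq x 0;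
    first by rewrite mulmx0 -(scale0r 0) !dotvZl !mul0r mulr0.
  have xx0 : 0 < dotv x x by rewrite -sqr_vnorm2 exprn_gt0// vnorm2_gt0.
  pose y := invmx B *m x.
  have By : B *m y = x by rewrite /y mulmxA mulmxV// mul1mx.
  have := psd_Cauchy_Schwarz x y Bsym Bpos; rewrite By => CS.
  rewrite -(ler_pM2r xx0) -expr2 (le_trans CS)// -mulrA [leRHS]mulrCA.
  rewrite ler_wpM2l//.
  rewrite (le_trans (Cauchy_Schwarz _ _))// -sqr_vnorm2 expr2 mulrA.
  rewrite ler_wpM2r ?vnorm2_ge0// (le_trans (ler_vnorm2_mulmx _ _))//.
  by rewrite ler_wpM2r ?vnorm2_ge0// lerDl.
(* [kermx] collects rows [v] with [v B = 0]; symmetry of [B] makes [v^T] the eigenvector. *)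
have : kermx B != 0.
  by rewrite kermx_eq0 row_free_unit.
case/rowV0Pn => v /sub_kermxP vB v0.
exists v^T; first by rewrite trmx_eq0.
apply/eqP; rewrite -subr_eq0 -mul_scalar_mx -mulmxBl -/B.
by rewrite -trmx_eq0 trmx_mul trmxK Bsym vB.
Qed.

(** [eigenvalue] speaks of row vectors; symmetry of the Gram matrix transfers it to columns. *)
Lemma singular_valueP m n (A : 'M[R]_(m, n)) t : 0 <= t ->
  (exists2 x : 'cV_n, x != 0 & A^T *m A *m x = t ^+ 2 *: x)
  <-> singular_values A t.
Proof.
move=> t0; have sym : (A^T *m A)^T = A^T *m A by rewrite trmx_mul trmxK.
split => [[x x0 Ax]|[_ /eigenvalueP[v vA v0]]].
  split => //; apply/eigenvalueP; exists x^T; last by rewrite trmx_eq0.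
  by rewrite -[in LHS]sym -trmx_mul Ax linearZ.
exists v^T; first by rewrite trmx_eq0.
by rewrite -[in LHS]sym -trmx_mul vA linearZ.
Qed.

Lemma singular_value_vnorm2 m n (A : 'M[R]_(m, n)) t : singular_values A t ->
  exists2 x : 'cV_n, x != 0 & vnorm2 (A *m x) = t * vnorm2 x.
Proof.
move=> At; have t0 : 0 <= t by case: At.
have [x x0 Ax] := (singular_valueP A t0).2 At.
exists x => //; apply: (@pexpIrn _ 2) => //;
  rewrite ?nnegrE ?mulr_ge0 ?vnorm2_ge0//.
by rewrite exprMn !sqr_vnorm2 dotv_mulmxl mulmxA Ax dotvZr.
Qed.

(** The norm is attained, without compactness: [- |A|^2] is a tight lower bound of the form of
    [- A^T A], for if it could be raised by [c], then [sqrt (|A|^2 - c)] would bound the norm. *)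
Lemma singular_values_mxnorm2 m n (A : 'M[R]_(m, n)) : (0 < n)%N ->
  singular_values A (mxnorm2 A).
Proof.
move=> n0; apply/singular_valueP; first exact: mxnorm2_ge0.
have [|||x x0 Ax] := @tight_lower_bound_eigenvector n (- (A^T *m A)) (- mxnorm2
  A ^+ 2).
- by rewrite linearN /= trmx_mul trmxK.
- move=> x; rewrite mulNmx dotvNr mulNr lerN2 -mulmxA -dotv_mulmxl.
  by rewrite -le_vnorm2 ?mxnorm2_ge0// ler_vnorm2_mulmx.
- move=> c c0; apply: contrapT => /forallNP H.
  have {}H x : dotv (A *m x) (A *m x) <= (mxnorm2 A ^+ 2 - c) * dotv x x.
    have /negP := H x; rewrite -leNgt mulNmx dotvNr -mulmxA -dotv_mulmxl.
    by rewrite lerNr -mulNr opprD opprK.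
  (* A unit vector forces [|A|^2 - c >= 0]; on a negative number [Num.sqrt] would return 0. *)
  have [x x1] := @exists_unit_vector R n n0.
  have d0 : 0 <= mxnorm2 A ^+ 2 - c.
    have := le_trans (dotvv_ge0 _) (H x).
    by rewrite -(sqr_vnorm2 x) x1 expr1n mulr1.
  have : mxnorm2 A <= Num.sqrt (mxnorm2 A ^+ 2 - c).
    apply: mxnorm2_le => [|y]; first exact: sqrtr_ge0.
    by rewrite le_vnorm2 ?sqrtr_ge0// sqr_sqrtr.
  rewrite -(@ler_pXn2r _ 2)// ?nnegrE ?mxnorm2_ge0 ?sqrtr_ge0//.
  by rewrite sqr_sqrtr//; lra.
exists x => //; move: Ax; rewrite mulNmx scaleNr => /eqP.
by rewrite eqr_opp => /eqP.
Qed.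

Lemma sup_singular_values m n (A : 'M[R]_(m, n)) : (0 < n)%N ->
  sup (singular_values A) = mxnorm2 A.
Proof.
move=> n0; have Amem := @singular_values_mxnorm2 m n A n0.
have ub : ubound (singular_values A) (mxnorm2 A).
  move=> t /singular_value_vnorm2[x x0 Ax].
  by rewrite -vnorm2_gt0 in x0; rewrite -(ler_pM2r x0) -Ax ler_vnorm2_mulmx.
apply/eqP; rewrite eq_le; apply/andP; split.
  by apply: ge_sup => //; exists (mxnorm2 A).
by apply: ub_le_sup => //; exists (mxnorm2 A).
Qed.

(** Plays the part of [sigma_min A >= sigma] without naming a singular value, which makes isometries
    and perturbations easy to handle. *)
Definition lower_gain m n (A : 'M[R]_(m, n)) sigma :=
  forall x, sigma * vnorm2 x <= vnorm2 (A *m x).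

(** The infimum of [|A x|] over unit vectors is a gain, and it is itself a singular value by the
    tight-bound lemma for [A^T A]; so the infimum of the singular values is no larger. *)
Lemma lower_gain_inf m n (A : 'M[R]_(m, n)) :
  lower_gain A (inf (singular_values A)).
Proof.
case: (posnP n) => [n0|n0].
  move: A; rewrite n0 => A x.
  by rewrite flatmx0 vnorm2_0 mulr0 vnorm2_ge0.
pose E := [set vnorm2 (A *m x) | x in [set x : 'cV[R]_n | vnorm2 x = 1]].
have [x0 x01] := @exists_unit_vector R n n0.
have E0 : E !=set0 by exists (vnorm2 (A *m x0)), x0.
have lbE : lbound E 0 by move=> _ [x _ <-]; exact: vnorm2_ge0.
have infE0 : 0 <= inf E by apply: lb_le_inf.
have gainE : lower_gain A (inf E).
  move=> x; have [->|xn0] := eqVneq x 0;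
    first by rewrite mulmx0 !vnorm2_0 mulr0.
  have nx0 : 0 < vnorm2 x by rewrite vnorm2_gt0.
  rewrite -ler_pdivlMr// mulrC.
  have -> : (vnorm2 x)^-1 * vnorm2 (A *m x)
      = vnorm2 (A *m ((vnorm2 x)^-1 *: x)).
    by rewrite -scalemxAr vnorm2Z ger0_norm ?invr_ge0// ltW.
  apply: ge_inf; first by exists 0.
  by exists ((vnorm2 x)^-1 *: x) => //; exact: vnorm2_normalize.
suff : singular_values A (inf E).
  move=> AE x; apply: le_trans (gainE x); rewrite ler_wpM2r ?vnorm2_ge0//.
  by apply: ge_inf => //; exists 0 => t [].
apply/singular_valueP => //; apply: tight_lower_bound_eigenvector.
- by rewrite trmx_mul trmxK.
- by move=> x; rewrite -mulmxA -dotv_mulmxl -ge_vnorm2.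
- move=> c c0; apply: contrapT => /forallNP H.
  have {}H x : (inf E ^+ 2 + c) * dotv x x <= dotv (A *m x) (A *m x).
    by have /negP := H x; rewrite -leNgt -mulmxA -dotv_mulmxl.
  have d0 : 0 <= inf E ^+ 2 + c by rewrite addr_ge0 ?sqr_ge0 ?ltW.
  have : Num.sqrt (inf E ^+ 2 + c) <= inf E.
    apply: lb_le_inf => // _ [x /= x1 <-].
    rewrite -[leLHS]mulr1 -x1.
    by rewrite ge_vnorm2 ?sqrtr_ge0// sqr_sqrtr.
  rewrite -(@ler_pXn2r _ 2)// ?nnegrE ?sqrtr_ge0//.
  by rewrite sqr_sqrtr//; lra.
Qed.

(** This and [cond2_lty] are the only places where [cond2] is unfolded. *)
Lemma cond2_le m n (A : 'M[R]_(m, n)) sigma K : (0 < n)%N -> 0 < sigma ->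
  lower_gain A sigma -> mxnorm2 A <= K * sigma -> (cond2 A <= K%:E)%E.
Proof.
move=> n0 s0 gain AK; rewrite /cond2 sup_singular_values//.
have sinf : sigma <= inf (singular_values A).
  apply: lb_le_inf; first by exists (mxnorm2 A); exact: singular_values_mxnorm2.
  move=> t /singular_value_vnorm2[x x0 Ax].
  by rewrite -vnorm2_gt0 in x0; rewrite -(ler_pM2r x0) -Ax.
have inf0 := lt_le_trans s0 sinf.
rewrite gt_eqF// lee_fin ler_pdivrMr// (le_trans AK)// ler_wpM2l//.
by rewrite -(pmulr_lge0 _ s0) (le_trans (mxnorm2_ge0 A)).
Qed.

Lemma cond2_lty m n (A : 'M[R]_(m, n)) : (0 < n)%N -> (cond2 A < +oo)%E ->
  exists sigma, [/\ 0 < sigma, lower_gain A sigma &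
    cond2 A = (mxnorm2 A / sigma)%:E].
Proof.
move=> n0; rewrite /cond2; case: ifPn => [_|inf0 _]; first by rewrite ltxx.
exists (inf (singular_values A)); split.
- rewrite lt_neqAle eq_sym inf0; apply: lb_le_inf => [|t []//].
  by exists (mxnorm2 A); exact: singular_values_mxnorm2.
- exact: lower_gain_inf.
- by rewrite sup_singular_values.
Qed.

Lemma lower_gain_le_mxnorm2 m n (A : 'M[R]_(m, n)) sigma : (0 < n)%N ->
  lower_gain A sigma -> sigma <= mxnorm2 A.
Proof.
move=> n0 gain; have [x x1] := @exists_unit_vector R n n0.
by have := le_trans (gain x) (ler_vnorm2_mulmx A x); rewrite x1 !mulr1.
Qed.

End SingularValues.

(** * Rounding errors of sums, products and entrywise operations *)

Section RoundingErrors.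
Variable R : realType.
Variable u : R.
Hypotheses (u0 : 0 <= u) (u1 : u <= 1).

Lemma fl_rnd_error (x y : R) : fl_rnd u x y -> `|y - x| <= u * `|x|.
Proof.
case=> d du ->.
have -> : x * (1 + d) - x = d * x by ring.
by rewrite normrM ler_wpM2r.
Qed.

(** The factor is uniform in the order of summation. Both parts are nonempty, so each has at most
    [n - 1] terms and, with [h = 2^(n-1)], error factor at most [(h - 1) u]. Hence
    [|y1 + y2| <= h (a1 + a2)] by [u <= 1], and the last addition brings the total to
    [(h - 1) u + h u = (2^n - 1) u]. *)
Lemma fl_sum_error t (y : R) : fl_sum u t y ->
  (0 < size t)%N /\
  `|y - \sum_(x <- t) x| <= (2 ^+ size t - 1) * u * \sum_(x <- t) `|x|.
Proof.
elim=> [x|{}t t1 t2 y1 y2 {}y tE _ [n1 IH1] _ [n2 IH2] /fl_rnd_error yE].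
  by split => //; rewrite !big_seq1 subrr normr0 mulr_ge0 ?mulr_ge0//= expr1;
    lra.
rewrite !(perm_big _ tE) !big_cat (perm_size tE) size_cat addn_gt0 n1;
  split => //=.
set n := (size t1 + size t2)%N in yE *.
set s1 := \sum_(x <- t1) x in IH1 *; set s2 := \sum_(x <- t2) x in IH2 *.
set a1 := \sum_(x <- t1) `|x| in IH1 *; set a2 := \sum_(x <- t2) `|x| in IH2 *.
have sa1 : `|s1| <= a1 by exact: ler_norm_sum.
have sa2 : `|s2| <= a2 by exact: ler_norm_sum.
have a10 : 0 <= a1 by exact: sumr_ge0.
have a20 : 0 <= a2 by exact: sumr_ge0.
pose h : R := 2 ^+ n.-1.
have hn : 2 ^+ n = 2 * h by rewrite /h -exprS prednK// addn_gt0 n1.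
have h1 : 2 ^+ size t1 <= h :> R by rewrite ler_eXn2l ?ltr1n// /n -(prednK n2)
  addnS leq_addr.
have h2 : 2 ^+ size t2 <= h :> R by rewrite ler_eXn2l ?ltr1n// /n -(prednK n1)
  addSn leq_addl.
have {h1}IH1 : `|y1 - s1| <= (h - 1) * u * a1.
  by rewrite (le_trans IH1)// !ler_wpM2r// lerB.
have {h2}IH2 : `|y2 - s2| <= (h - 1) * u * a2.
  by rewrite (le_trans IH2)// !ler_wpM2r// lerB.
have h1 : 1 <= h by rewrite /h exprn_ege1// ler1n.
have n12 : `|y1 + y2| <= h * (a1 + a2).
  have -> : y1 + y2 = (y1 - s1) + (y2 - s2) + s1 + s2 by ring.
  rewrite (le_trans (ler_normD _ _))// -lerBrDr (le_trans (ler_normD _ _))//.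
  rewrite -lerBrDr (le_trans (ler_normD _ _))//.
  have : (h - 1) * u * (a1 + a2) <= (h - 1) * (a1 + a2).
    by rewrite ler_wpM2r ?addr_ge0// ler_piMr// subr_ge0.
  by lra.
have -> : y - (s1 + s2) = (y - (y1 + y2)) + ((y1 - s1) + (y2 - s2)) by ring.
rewrite (le_trans (ler_normD _ _))//.
have : `|y1 - s1 + (y2 - s2)| <= (h - 1) * u * (a1 + a2).
  by rewrite (le_trans (ler_normD _ _))// mulrDr lerD.
have : u * `|y1 + y2| <= u * (h * (a1 + a2)) by rewrite ler_wpM2l.
by rewrite hn; lra.
Qed.

(** For one [d] bounding all dimensions: [d * 2^(d+2)] covers the error of an inner product of
    length at most [d], and [d^2] passes from entries to the norm. *)
Definition rounding_factor (d : nat) : R := (d ^ 3)%:R * 2 ^+ d.+2.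

Lemma rounding_factor_ge0 d : 0 <= rounding_factor d.
Proof. by rewrite mulr_ge0 ?exprn_ge0. Qed.

Lemma fl_mulmx_error d m n q (A : 'M[R]_(m, n)) (B : 'M[R]_(n, q)) C :
  (m <= d)%N -> (n <= d)%N -> (q <= d)%N -> fl_mulmx u A B C ->
  mxnorm2 (C - A *m B) <= rounding_factor d * u * (mxnorm2 A * mxnorm2 B).
Proof.
move=> md nd qd AB; set N := mxnorm2 A * mxnorm2 B.
have N0 : 0 <= N by rewrite mulr_ge0 ?mxnorm2_ge0.
pose e := d%:R * 2 ^+ d.+2 * u * N.
have e0 : 0 <= e by rewrite 3?mulr_ge0// ?mxnorm2_ge0.
have He i k : `|(C - A *m B) i k| <= e.
  have [P PE /fl_sum_error[_]] := AB i k.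
  rewrite size_codom card_ord !big_image /= => CE.
  have term j : `|A i j * B j k| <= N by rewrite normrM ler_pM ?mxnorm2_entry.
  have termP j : `|P j - A i j * B j k| <= u * N.
    by rewrite (le_trans (fl_rnd_error (PE j)))// ler_wpM2l.
  have P2 j : `|P j| <= 2 * N.
    rewrite -(subrK (A i j * B j k) (P j)) (le_trans (ler_normD _ _))//.
    have : u * N <= N by rewrite ler_piMl.
    by have := termP j; have := term j; lra.
  have sumP : \sum_j `|P j| <= n%:R * (2 * N).
    rewrite (le_trans (ler_sum _ (fun j _ => P2 j)))//.
    by rewrite sumr_const card_ord -[leLHS]mulr_natl.
  have sumE : `|\sum_j P j - (A *m B) i k| <= n%:R * (u * N).
    rewrite mxE -sumrB (le_trans (ler_norm_sum _ _ _))//.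
    rewrite (le_trans (ler_sum _ (fun j _ => termP j)))//.
    by rewrite sumr_const card_ord -[leLHS]mulr_natl.
  have -> : (C - A *m B) i k = (C i k - \sum_j P j) + (\sum_j P j - (A *m B) i
    k).
    by rewrite !mxE; ring.
  rewrite (le_trans (ler_normD _ _))//.
  have nle : n%:R <= d%:R :> R by rewrite ler_nat.
  have p1 : 1 <= 2 ^+ n :> R by rewrite exprn_ege1// ler1n.
  have pnd : 2 ^+ n <= 2 ^+ d :> R by rewrite ler_eXn2l// ltr1n.
  have : (2 ^+ n - 1) * u * (\sum_j `|P j|) <= (2 ^+ n - 1) * u * (n%:R * (2 *
    N)).
    by rewrite ler_wpM2l// mulr_ge0// subr_ge0.
  have uN0 : 0 <= u * N by exact: mulr_ge0.
  have : n%:R * 2 ^+ n * (u * N) <= d%:R * 2 ^+ d * (u * N).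
    by apply: ler_wpM2r => //; apply: ler_pM => //; exact: le_trans p1.
  have : 0 <= d%:R * 2 ^+ d * (u * N) by rewrite mulr_ge0.
  have : 0 <= n%:R * (u * N) by rewrite mulr_ge0.
  by rewrite /e exprSr exprSr; move: CE sumE; lra.
rewrite (le_trans (mxnorm2_le_entries He))// ger0_norm//.
have -> : rounding_factor d * u * N = (d * d)%:R * e.
  by rewrite /rounding_factor /e !natrM; ring.
by rewrite ler_wpM2r// ler_nat leq_mul.
Qed.

Lemma entrywise_fl_error d m n (A C : 'M[R]_(m, n)) a :
  (m <= d)%N -> (n <= d)%N -> mxnorm2 A <= a ->
  (forall i j, fl_rnd u (A i j) (C i j)) ->
  mxnorm2 (C - A) <= rounding_factor d * u * a.
Proof.
move=> md nd Aa AC.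
have a0 : 0 <= a by rewrite (le_trans (mxnorm2_ge0 A)).
have He i j : `|(C - A) i j| <= u * a.
  have := fl_rnd_error (AC i j); rewrite !mxE => /le_trans->//.
  by rewrite ler_wpM2l// (le_trans (mxnorm2_entry _ _ _)).
rewrite (le_trans (mxnorm2_le_entries He))// ger0_norm ?mulr_ge0// mulrA.
rewrite !ler_wpM2r// /rounding_factor.
case: d md nd => [|d] md nd.
  by move: md; rewrite leqn0 => /eqP->; rewrite mul0n mul0r.
rewrite (@le_trans _ _ (d.+1 ^ 3)%:R)//; last first.
  by rewrite ler_peMr// exprn_ege1// ler1n.
rewrite ler_nat; apply: (@leq_trans (d.+1 * d.+1)); first exact: leq_mul.
by rewrite !expnS expn0 muln1 mulnA leq_pmulr.
Qed.

Lemma fl_addmx_error d m n (A B C : 'M[R]_(m, n)) a b :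
  (m <= d)%N -> (n <= d)%N -> mxnorm2 A <= a -> mxnorm2 B <= b ->
  fl_addmx u A B C -> mxnorm2 (C - (A + B)) <= rounding_factor d * u * (a + b).
Proof.
move=> md nd Aa Bb H; apply: entrywise_fl_error => // [|i j].
  by rewrite (le_trans (ler_mxnorm2D _ _))// lerD.
by rewrite mxE; exact: H.
Qed.

Lemma fl_submx_error d m n (A B C : 'M[R]_(m, n)) a b :
  (m <= d)%N -> (n <= d)%N -> mxnorm2 A <= a -> mxnorm2 B <= b ->
  fl_submx u A B C -> mxnorm2 (C - (A - B)) <= rounding_factor d * u * (a + b).
Proof.
move=> md nd Aa Bb H; apply: entrywise_fl_error => // [|i j].
  by rewrite (le_trans (ler_mxnorm2B _ _))// lerD.
by rewrite !mxE; exact: H.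
Qed.

End RoundingErrors.

(** * One projection pass, then two in succession *)

Section GramSchmidtStep.
Variable R : realType.

(** The two comparisons of [V] serve different ends: with the computed [S] it yields the residual of
    the factorization, with the exact [Q^T X] it gives access to the bounds on [I - Q Q^T]. *)
Lemma gram_schmidt_pass (d : nat) : exists2 a : R, 0 <= a &
  forall m r s (u : R) (Q : 'M[R]_(m, r)) (X : 'M[R]_(m, s)) S QS V,
    (m <= d)%N -> (r <= d)%N -> (s <= d)%N -> 0 <= u -> u <= 1 ->
    mxnorm2 (Q^T *m Q - 1%:M) <= 1 ->
    fl_mulmx u Q^T X S -> fl_mulmx u Q S QS -> fl_submx u X QS V ->
    [/\ mxnorm2 S <= a * mxnorm2 X,
        mxnorm2 (V - (X - Q *m S)) <= a * u * mxnorm2 X &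
        mxnorm2 (V - (X - Q *m (Q^T *m X))) <= a * u * mxnorm2 X].
Proof.
set g : R := rounding_factor R d; have g0 : 0 <= g := rounding_factor_ge0 R d.
(* [c] bounds [|S| / |X|]: 2 from [|Q^T X|], [2 g] from rounding. As [c^2 = 2 c + 2 g c], it also
   gives [|QS| <= c^2 |X|]. *)
pose c := 2 + 2 * g; have c0 : 0 <= c by rewrite /c; lra.
pose a := c + g * 2 * c + g * (1 + c ^+ 2) + 4 * g.
have gc0 : 0 <= g * 2 * c by rewrite 2?mulr_ge0.
have gcc0 : 0 <= g * (1 + c ^+ 2) by rewrite mulr_ge0 ?addr_ge0 ?sqr_ge0.
exists a; first by rewrite /a; lra.
move=> m r s u Q X S QS V md rd sd u0 u1 Qorth SE QSE VE.
have Q2 := mxnorm2_le_gram Qorth.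
have := mxnorm2_ge0 X; set x := mxnorm2 X => x0.
have ux0 : 0 <= u * x by rewrite mulr_ge0.
have ux1 : u * x <= x by rewrite ler_piMl.
have gu0 : 0 <= g * u by rewrite mulr_ge0.
have trQ2 : mxnorm2 Q^T <= 2 by rewrite mxnorm2_tr.
have QX : mxnorm2 (Q^T *m X) <= 2 * x := ler_mxnorm2M_bound trQ2 (lexx _).
have dS : mxnorm2 (S - Q^T *m X) <= g * u * (2 * x).
  rewrite (le_trans (fl_mulmx_error u0 u1 rd md sd SE))//.
  by apply: ler_wpM2l => //; apply: ler_wpM2r => //.
have S_le : mxnorm2 S <= c * x.
  rewrite -(subrK (Q^T *m X) S) (le_trans (ler_mxnorm2D _ _))//.
  have : g * (u * x) <= g * x by rewrite ler_wpM2l.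
  by move: QX dS; rewrite /c; clear; lra.
have dQS : mxnorm2 (QS - Q *m S) <= g * u * (2 * (c * x)).
  rewrite (le_trans (fl_mulmx_error u0 u1 md rd sd QSE))//.
  by apply: ler_wpM2l => //; apply: ler_pM; rewrite ?mxnorm2_ge0.
have QS_le : mxnorm2 QS <= c ^+ 2 * x.
  rewrite -(subrK (Q *m S) QS) (le_trans (ler_mxnorm2D _ _))//.
  have : mxnorm2 (Q *m S) <= 2 * (c * x) by exact: ler_mxnorm2M_bound.
  have : g * c * (u * x) <= g * c * x by rewrite ler_wpM2l// mulr_ge0.
  have -> : c ^+ 2 = 2 * c + 2 * g * c by rewrite /c; ring.
  by lra.
have dV := fl_submx_error u0 md sd (lexx x) QS_le VE.
have V1 : mxnorm2 (V - (X - Q *m S)) <= (g * 2 * c + g * (1 + c ^+ 2)) * u * x.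
  have -> : V - (X - Q *m S) = (V - (X - QS)) - (QS - Q *m S).
    by rewrite !opprB; apply/matrixP => i j; rewrite !mxE; ring.
  by rewrite (le_trans (ler_mxnorm2B _ _))//; move: dV dQS; rewrite -/g; clear;
    lra.
have V2 : mxnorm2 (Q *m (S - Q^T *m X)) <= 4 * g * u * x.
  by rewrite (le_trans (ler_mxnorm2M_bound Q2 dS))//; clear; lra.
split.
- by rewrite (le_trans S_le)// ler_wpM2r// /a; move: gc0 gcc0 g0; clear; lra.
- by rewrite (le_trans V1)// -mulrA -[leRHS]mulrA ler_wpM2r// /a; move: c0 g0;
    clear; lra.
- have -> : V - (X - Q *m (Q^T *m X))
      = (V - (X - Q *m S)) - Q *m (S - Q^T *m X).
    by rewrite mulmxBr; apply/matrixP => i j; rewrite !mxE; ring.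
  rewrite (le_trans (ler_mxnorm2B _ _))// (le_trans (lerD V1 V2))//.
  by rewrite -mulrDl -mulrDl -mulrA -[leRHS]mulrA ler_wpM2r// /a; move: c0 g0;
    clear; lra.
Qed.

Lemma reorthogonalization (d : nat) : exists2 b : R, 0 <= b &
  forall m r s (u delta : R) (Q : 'M[R]_(m, r)) (X : 'M[R]_(m, s)) S QS V Y QY
    W C,
    (m <= d)%N -> (r <= d)%N -> (s <= d)%N -> 0 <= u -> u <= 1 ->
    mxnorm2 (Q^T *m Q - 1%:M) <= delta -> delta <= 1 ->
    fl_mulmx u Q^T X S -> fl_mulmx u Q S QS -> fl_submx u X QS V ->
    fl_mulmx u Q^T V Y -> fl_mulmx u Q Y QY -> fl_submx u V QY W ->
    fl_addmx u S Y C ->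
    [/\ mxnorm2 W <= (1 + b * u) * mxnorm2 X,
        mxnorm2 (W - (X - Q *m C)) <= b * u * mxnorm2 X &
        mxnorm2 (Q^T *m W) <= b * (delta ^+ 2 + u) * mxnorm2 X].
Proof.
have [a a0 pass] := gram_schmidt_pass d.
set g : R := rounding_factor R d; have g0 : 0 <= g := rounding_factor_ge0 R d.
(* Bounds [|S| + |Y|] relative to [|X|], as [|Y| <= a |V|] and [|V| <= (1 + a) |X|]. *)
pose c := a + a * (1 + a);
  have c0 : 0 <= c by rewrite addr_ge0 ?mulr_ge0 ?addr_ge0.
have aa0 : 0 <= a * a by rewrite mulr_ge0.
have gc0 : 0 <= g * c by rewrite mulr_ge0.
(* The 2 goes with [delta^2], [4 a + 2 a^2] with the rounding of both passes seen through [Q^T], and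
   [2 g c] with the rounded sum of [S] and [Y]. *)
pose b := 2 + 4 * a + 2 * (a * a) + 2 * (g * c).
exists b; first by rewrite /b; lra.
move=> m r s u delta Q X S QS V Y QY W C md rd sd u0 u1 Qd d1.
move=> SE QSE VE YE QYE WE CE.
have Q1 := le_trans Qd d1; have Q2 := mxnorm2_le_gram Q1.
have d0 : 0 <= delta := le_trans (mxnorm2_ge0 _) Qd.
have [S_le VS VX] := pass _ _ _ _ _ _ _ _ _ md rd sd u0 u1 Q1 SE QSE VE.
have [Y_le WY WV] := pass _ _ _ _ _ _ _ _ _ md rd sd u0 u1 Q1 YE QYE WE.
have x0 := mxnorm2_ge0 X; have v0 := mxnorm2_ge0 V.
move: S_le VS VX Y_le WY WV v0 x0.
set x := mxnorm2 X; set v := mxnorm2 V => S_le VS VX Y_le WY WV v0 x0.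
have ux0 : 0 <= u * x by rewrite mulr_ge0.
have ux1 : u * x <= x by rewrite ler_piMl.
have uv0 : 0 <= u * v by rewrite mulr_ge0.
have aux0 : 0 <= a * (u * x) by rewrite mulr_ge0.
have aux1 : a * (u * x) <= a * x by rewrite ler_wpM2l.
have v_le : v <= (1 + a * u) * x.
  rewrite /v -(subrK (X - Q *m (Q^T *m X)) V) (le_trans (ler_mxnorm2D _ _))//.
  by have := sub_mulmx_tr_project X Q1; move: VX; rewrite -/x; clearbody x;
    clear; lra.
have v_le' : v <= (1 + a) * x by move: v_le aux1; clear; lra.
have uv_le : u * v <= (1 + a) * (u * x) by rewrite mulrCA ler_wpM2l.
have auv_le : a * (u * v) <= a * ((1 + a) * (u * x)) by rewrite ler_wpM2l.
have av_le : a * v <= a * ((1 + a) * x) by rewrite ler_wpM2l.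
have aaux0 : 0 <= a * a * (u * x) by rewrite mulr_ge0.
have gcux0 : 0 <= g * c * (u * x) by rewrite mulr_ge0.
split.
- rewrite -(subrK (V - Q *m (Q^T *m V)) W) (le_trans (ler_mxnorm2D _ _))//.
  have := sub_mulmx_tr_project V Q1; rewrite -/v /b.
  by move: WV v_le auv_le aux0 ux0 gcux0 aaux0; clear; lra.
- have Y_le' : mxnorm2 Y <= a * ((1 + a) * x) by exact: le_trans av_le.
  have dC := fl_addmx_error u0 rd sd S_le Y_le' CE.
  have dQC := ler_mxnorm2M_bound Q2 dC.
  have -> : W - (X - Q *m C) = (W - (V - Q *m Y)) + (V - (X - Q *m S))
      + Q *m (C - (S + Y)).
    rewrite !(mulmxBr, mulmxDr).
    by apply/matrixP => i j; rewrite !mxE; ring.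
  rewrite (le_trans (ler_mxnorm2D _ _))// -lerBrDr.
  rewrite (le_trans (ler_mxnorm2D _ _))//.
  move: dQC; rewrite -/g /b /c.
  move: WY VS auv_le ux0 aux0 aaux0; clearbody g x v; clear.
  by do 3![move: (mxnorm2 _) => ?]; lra.
(* [Q^T (I - Q Q^T) = (I - Q^T Q) Q^T], so each exact pass shrinks the component along [Q] by
   delta. *)
- have proj q (Z : 'M[R]_(m, q)) :
      mxnorm2 (Q^T *m (Z - Q *m (Q^T *m Z))) <= delta * mxnorm2 (Q^T *m Z).
    rewrite mulmxBr !mulmxA -!(mulmxA _ Q^T) -{1}(mul1mx (Q^T *m Z)) -mulmxBl.
    by apply: ler_mxnorm2M_bound (lexx _); rewrite mxnorm2_subC.
  have trQ2 : mxnorm2 Q^T <= 2 by rewrite mxnorm2_tr.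
  have QX : mxnorm2 (Q^T *m X) <= 2 * x := ler_mxnorm2M_bound trQ2 (lexx _).
  have QV : mxnorm2 (Q^T *m V) <= 2 * delta * x + 2 * a * (u * x).
    rewrite -(subrK (X - Q *m (Q^T *m X)) V) mulmxDr.
    rewrite (le_trans (ler_mxnorm2D _ _))//.
    have := ler_mxnorm2M_bound trQ2 VX.
    have := le_trans (proj _ X) (ler_wpM2l d0 QX); clearbody x; clear.
    by do 2![move: (mxnorm2 _) => ?]; lra.
  have dux : delta * (u * x) <= u * x by rewrite ler_piMl.
  have adux : a * (delta * (u * x)) <= a * (u * x) by rewrite ler_wpM2l.
  rewrite -(subrK (V - Q *m (Q^T *m V)) W) mulmxDr.
  rewrite (le_trans (ler_mxnorm2D _ _))//.
  have := ler_mxnorm2M_bound trQ2 WV.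
  have := le_trans (proj _ V) (ler_wpM2l d0 QV).
  have ddx0 : 0 <= delta * delta * x by rewrite !mulr_ge0.
  have addx0 : 0 <= a * (delta * delta * x) by rewrite mulr_ge0.
  have aaddx0 : 0 <= a * a * (delta * delta * x) by rewrite mulr_ge0.
  have gcddx0 : 0 <= g * c * (delta * delta * x) by rewrite mulr_ge0.
  rewrite /b; move: auv_le adux ddx0 addx0 aaddx0 gcddx0 ux0 aux0 aaux0 gcux0.
  by clearbody g c x v; clear; do 2![move: (mxnorm2 _) => ?]; lra.
Qed.

End GramSchmidtStep.

(** * Block columns as products with isometries *)

Section BlockSelection.
Variables (R : realType) (s p : nat).
Local Notation N := (\sum_(k < p) s)%N.

(* Isometric embeddings of block k and of the blocks before it: X *m block_sel k
   is X_k and X *m prefix_sel k is [X_0 ... X_(k-1)]. *)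
Definition block_sel (k : 'I_p) : 'M[R]_(N, s) := submxrow 1%:M k.

Definition prefix_sel (k : 'I_p) : 'M[R]_(N, \sum_(j < k) s) :=
  \mxrow_(j < k) block_sel (before j).

(** Indexed by a natural number so that [k = p] is allowed, and of full size so that an induction on
    [k] never changes dimensions. *)
Definition prefix_proj (k : nat) : 'M[R]_N :=
  \sum_(j < p | (j < k)%N) block_sel j *m (block_sel j)^T.

Lemma mul_block_sel m (A : 'M[R]_(m, N)) k : A *m block_sel k = submxrow A k.
Proof. by rewrite mul_submxrow mulmx1. Qed.

Lemma mul_prefix_sel m (A : 'M[R]_(m, N)) (k : 'I_p) :
  A *m prefix_sel k = \mxrow_(j < k) submxrow A (before j).
Proof. by rewrite mul_mxrow; apply/eq_mxrowP => j; rewrite mul_block_sel. Qed.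

Lemma tr_block_sel_mul m (A : 'M[R]_(N, m)) k :
  (block_sel k)^T *m A = submxcol A k.
Proof. by rewrite tr_submxrow trmx1 submxcol_mul mul1mx. Qed.

Lemma block_sel_mul (A : 'M[R]_N) i j :
  (block_sel i)^T *m (A *m block_sel j) = submxblock A i j.
Proof. by rewrite mul_block_sel tr_block_sel_mul submxblockEh. Qed.

Lemma block_sel_isometry k : (block_sel k)^T *m block_sel k = 1%:M.
Proof.
by rewrite -[X in _ *m X]mul1mx block_sel_mul -mxdiagZ submxblock_diag.
Qed.

Lemma block_sel_orth i j : i != j -> (block_sel i)^T *m block_sel j = 0.
Proof.
move=> ij; rewrite -[X in _ *m X]mul1mx block_sel_mul -mxdiagZ mxblockK.
by rewrite (negbTE ij).
Qed.

Lemma tr_prefix_sel (k : 'I_p) :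
  (prefix_sel k)^T = \mxcol_(j < k) (block_sel (before j))^T.
Proof. exact: tr_mxrow. Qed.

Lemma prefix_sel_isometry k : (prefix_sel k)^T *m prefix_sel k = 1%:M.
Proof.
rewrite tr_prefix_sel mul_mxcol_mxrow -mxdiagZ; apply: eq_mxblock => i j.
have [<-|ij] := eqVneq i j; first by rewrite block_sel_isometry conform_mx_id.
by rewrite block_sel_orth.
Qed.

Lemma prefix_sel_orth k : (prefix_sel k)^T *m block_sel k = 0.
Proof.
rewrite tr_prefix_sel mxcol_mul -mxcol0; apply: eq_mxcol => j.
by rewrite block_sel_orth// -val_eqE /= ltn_eqF.
Qed.

Lemma prefix_sel_mul (A : 'M[R]_N) (k l : 'I_p) :
  (prefix_sel k)^T *m (A *m block_sel l)
  = \mxcol_(i < k) submxblock A (before i) l.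
Proof.
by rewrite tr_prefix_sel mxcol_mul; apply: eq_mxcol => i; rewrite block_sel_mul.
Qed.

Lemma prefix_sel_proj (k : 'I_p) :
  prefix_sel k *m (prefix_sel k)^T = prefix_proj k.
Proof.
rewrite tr_prefix_sel mul_mxrow_mxcol /prefix_proj.
(* The summand is extended to all naturals, as widening the index range from [k] to [p] requires. *)
pose F j := if insub j is Some i then block_sel i *m (block_sel i)^T else 0.
have FE (i : 'I_p) : F i = block_sel i *m (block_sel i)^T by rewrite /F valK.
transitivity (\sum_(i < k) F i); first by apply: eq_bigr => i _; rewrite -FE.
rewrite (big_ord_widen p F (ltnW (ltn_ord k))).
by apply: eq_bigr => i _; rewrite FE.
Qed.

Lemma prefix_proj0 : prefix_proj 0 = 0.
Proof. exact: big_pred0_eq. Qed.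

Lemma prefix_projS (k : 'I_p) :
  prefix_proj k.+1 = prefix_proj k + block_sel k *m (block_sel k)^T.
Proof.
rewrite /prefix_proj [LHS](bigD1 k)//= addrC; congr (_ + _).
apply: eq_bigl => j; rewrite ltnS leq_eqVlt -val_eqE.
by case: ltngtP.
Qed.

Lemma prefix_proj_full : prefix_proj p = 1%:M.
Proof.
rewrite /prefix_proj [LHS](eq_bigl xpredT) => [|j]; last exact: ltn_ord.
rewrite -mul_mxrow_mxcol submxrowK mul1mx.
by under eq_mxcol do rewrite tr_submxrow trmx1; rewrite submxcolK.
Qed.

Lemma block_sel_decomposition m (A : 'M[R]_(N, m)) :
  A = \sum_(j < p) block_sel j *m ((block_sel j)^T *m A).
Proof.
rewrite -[LHS]mul1mx -prefix_proj_full /prefix_proj mulmx_suml.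
by apply: eq_big => [j|j _]; rewrite ?ltn_ord// mulmxA.
Qed.

Lemma prefix_sel_decomposition m (A : 'M[R]_(N, m)) (k : 'I_p) :
  prefix_sel k *m ((prefix_sel k)^T *m A)
  = \sum_(j < p | (j < k)%N) block_sel j *m ((block_sel j)^T *m A).
Proof.
rewrite mulmxA prefix_sel_proj /prefix_proj mulmx_suml.
by apply: eq_bigr => j _; rewrite mulmxA.
Qed.

Section BlockUpperTriangular.
Variable T : 'M[R]_N.
Hypothesis Tup : forall i j : 'I_p, (j < i)%N -> submxblock T i j = 0.

Lemma block_upper_mul_block_sel k :
  T *m block_sel k = prefix_sel k *m ((prefix_sel k)^T *m (T *m block_sel k))
                     + block_sel k *m submxblock T k k.
Proof.
rewrite prefix_sel_decomposition [LHS]block_sel_decomposition.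
rewrite [LHS](bigID [pred j : 'I_p | (j < k)%N])/=; congr (_ + _).
rewrite [LHS](bigD1 k) ?ltnn//= block_sel_mul [X in _ + X]big1 ?addr0// => j.
rewrite -leqNgt => /andP[kj jk]; rewrite block_sel_mul Tup ?mulmx0//.
by rewrite ltn_neqAle kj andbT eq_sym.
Qed.

Lemma block_upper_mul_prefix_sel k :
  T *m prefix_sel k = prefix_sel k *m ((prefix_sel k)^T *m (T *m prefix_sel k)).
Proof.
rewrite prefix_sel_decomposition [LHS]block_sel_decomposition.
rewrite [LHS](bigID [pred j : 'I_p | (j < k)%N])/=.
rewrite -[RHS]addr0; congr (_ + _); apply: big1 => i; rewrite -leqNgt => ki.
rewrite mul_mxrow mul_mxrow.
rewrite (_ : \mxrow_(j < k) _ = 0) ?mulmx0// -mxrow0; apply: eq_mxrow => j.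
by rewrite block_sel_mul Tup//= (leq_trans (ltn_ord j)).
Qed.

End BlockUpperTriangular.

End BlockSelection.

(** * Perturbation estimates for one block, free of floating-point relations *)

Section StepEstimates.
Variable R : realType.

Lemma vnorm2_isometry m n (F : 'M[R]_(m, n)) x : F^T *m F = 1%:M ->
  vnorm2 (F *m x) = vnorm2 x.
Proof.
move=> F1; apply: (@pexpIrn _ 2) => //; rewrite ?nnegrE ?vnorm2_ge0//.
by rewrite !sqr_vnorm2 dotv_mulmxl mulmxA F1 mul1mx.
Qed.

Lemma mxnorm2_mul_isometry m n q (A : 'M[R]_(m, n)) (F : 'M[R]_(n, q)) :
  F^T *m F = 1%:M -> mxnorm2 (A *m F) <= mxnorm2 A.
Proof.
move=> F1; apply: mxnorm2_le => [|x]; first exact: mxnorm2_ge0.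
by rewrite -mulmxA (le_trans (ler_vnorm2_mulmx _ _))// vnorm2_isometry.
Qed.

Lemma lower_gain_isometry m n q (A : 'M[R]_(m, n)) (F : 'M[R]_(n, q)) sigma :
  F^T *m F = 1%:M -> lower_gain A sigma -> lower_gain (A *m F) sigma.
Proof.
by move=> F1 gain x; rewrite -mulmxA (le_trans _ (gain _))// vnorm2_isometry.
Qed.

Lemma lower_gainD m n (A B : 'M[R]_(m, n)) sigma e :
  lower_gain A sigma -> mxnorm2 B <= e -> lower_gain (A + B) (sigma - e).
Proof.
move=> gain Be x; rewrite mulmxDl (le_trans _ (lerB_vnorm2D _ _))//.
rewrite mulrBl lerB// (le_trans (ler_vnorm2_mulmx _ _))//.
by rewrite ler_wpM2r ?vnorm2_ge0.
Qed.

Lemma unitmx_inj n (A : 'M[R]_n) :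
  (forall x : 'cV_n, A *m x = 0 -> x = 0) -> A \in unitmx.
Proof.
move=> inj; rewrite -unitmx_tr -row_free_unit -kermx_eq0.
apply/rowV0P => v /sub_kermxP vA; apply/eqP; rewrite -trmx_eq0; apply/eqP.
by apply: inj; rewrite -[A]trmxK -trmx_mul vA trmx0.
Qed.

Lemma lower_gain_unitmx n (A : 'M[R]_n) sigma : 0 < sigma ->
  lower_gain A sigma -> A \in unitmx.
Proof.
move=> s0 gain; apply: unitmx_inj => x Ax; apply/eqP; rewrite -vnorm2_eq0.
have := gain x; rewrite Ax vnorm2_0 pmulr_rle0// => x0.
by rewrite eq_le x0 vnorm2_ge0.
Qed.

(* With E and F the selections of the blocks before k and of block k,
   W x = X z - (Q T - X) E w + (rounding) x, where w solves (E^T T E) w = C x and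
   z = F x - E w, so that |z| >= |x| and |z| >= |w|. *)
Lemma lower_gain_reorthogonalized m s p (X Q : 'M[R]_(m, \sum_(k < p) s)) T
    (k : 'I_p) (W : 'M[R]_(m, s)) (C : 'M[R]_(\sum_(j < k) s, s))
    sigma e1 e2 :
  (forall i j : 'I_p, (j < i)%N -> submxblock T i j = 0) ->
  lower_gain X sigma -> e1 < sigma ->
  mxnorm2 ((Q *m T - X) *m prefix_proj R s p k) <= e1 ->
  mxnorm2 (W - (X *m block_sel R s k - Q *m prefix_sel R s k *m C)) <= e2 ->
  lower_gain W (sigma - e1 - e2).
Proof.
set E := prefix_sel R s k; set F := block_sel R s k.
move=> Tup gain e1s resid We x.
have E1 : E^T *m E = 1%:M := prefix_sel_isometry R s k.
have F1 : F^T *m F = 1%:M := block_sel_isometry R s k.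
have EF : E^T *m F = 0 := prefix_sel_orth R s k.
have residE : mxnorm2 ((Q *m T - X) *m E) <= e1.
  have -> : E = prefix_proj R s p k *m E.
    by rewrite -prefix_sel_proj -mulmxA E1 mulmx1.
  by rewrite mulmxA (le_trans (mxnorm2_mul_isometry _ E1)).
pose Tp := E^T *m (T *m E).
have QETp : Q *m E *m Tp = X *m E + (Q *m T - X) *m E.
  by rewrite -mulmxA -block_upper_mul_prefix_sel// mulmxBl addrC subrK mulmxA.
(* [Q E Tp] is [X E] up to the residual, hence has gain [sigma - e1 > 0]; so [Tp] is injective. *)
have Tp_unit : Tp \in unitmx.
  have gainT := lower_gainD (lower_gain_isometry E1 gain) residE.
  apply: unitmx_inj => w Tw; apply/eqP; rewrite -vnorm2_eq0.
  have := gainT w; rewrite -QETp -mulmxA Tw mulmx0 vnorm2_0.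
  rewrite pmulr_rle0 ?subr_gt0// => w0.
  by rewrite eq_le w0 vnorm2_ge0.
pose w := invmx Tp *m (C *m x); pose z := F *m x - E *m w.
have Tpw : Tp *m w = C *m x by rewrite /w mulmxA mulmxV// mul1mx.
have zz : dotv z z = dotv x x + dotv w w.
  have FE : dotv (F *m x) (E *m w) = 0.
    rewrite dotvC dotv_mulmxl mulmxA EF mul0mx -(scale0r w) dotvC dotvZl.
    exact: mul0r.
  rewrite /z !(dotvDl, dotvDr, dotvNr) !(dotvC (- _)) !dotvNr.
  rewrite ?[dotv (E *m w) (F *m x)]dotvC FE -!sqr_vnorm2.
  rewrite (vnorm2_isometry _ F1) (vnorm2_isometry _ E1).
  by ring.
have xz : vnorm2 x <= vnorm2 z.
  by rewrite -[leRHS]mul1r le_vnorm2// zz expr1n mul1r lerDl dotvv_ge0.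
have wz : vnorm2 w <= vnorm2 z.
  by rewrite -[leRHS]mul1r le_vnorm2// zz expr1n mul1r lerDr dotvv_ge0.
have -> : W *m x = X *m z + ((W - (X *m F - Q *m E *m C)) *m x
    - (Q *m T - X) *m E *m w).
  have -> : X *m z = X *m F *m x - X *m E *m w by rewrite mulmxBr !mulmxA.
  have QEC : Q *m E *m C *m x = X *m E *m w + (Q *m T - X) *m E *m w.
    by rewrite -(mulmxA (Q *m E) C) -Tpw mulmxA QETp mulmxDl.
  rewrite !mulmxBl QEC -!mulmxBl.
  by apply/matrixP => i j; rewrite ![in LHS]mxE ![in RHS]mxE; ring.
have e10 : 0 <= e1 := le_trans (mxnorm2_ge0 _) resid.
have r1 : vnorm2 ((Q *m T - X) *m E *m w) <= e1 * vnorm2 z.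
  by rewrite (le_trans (ler_vnorm2_mulmx _ _))// ler_pM ?mxnorm2_ge0
    ?vnorm2_ge0.
have r2 : vnorm2 ((W - (X *m F - Q *m E *m C)) *m x) <= e2 * vnorm2 x.
  by rewrite (le_trans (ler_vnorm2_mulmx _ _))// ler_wpM2r ?vnorm2_ge0.
rewrite (le_trans _ (lerB_vnorm2D _ _))//.
have := ler_vnorm2B ((W - (X *m F - Q *m E *m C)) *m x) ((Q *m T - X) *m E *m
  w).
(* The residual costs [e1 |z|], so it is subtracted before [|z|] is lowered to [|x|]. *)
have : (sigma - e1) * vnorm2 x <= (sigma - e1) * vnorm2 z.
  by rewrite ler_wpM2l// subr_ge0 ltW.
by move: (gain z) r1 r2; clear; lra.
Qed.

(** [Qp^T Qk = Qp^T W Tkk^-1]. Since [|Qk| <= 2], the gain [tau] of [W] leaves [Tkk] a gain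
    [tau / 2], so the inverse has norm at most [2 / tau]. *)
Lemma cross_gram_le m r s (Qp : 'M[R]_(m, r)) (Qk W : 'M[R]_(m, s)) Tkk tau f :
  W = Qk *m Tkk -> 0 < tau -> lower_gain W tau -> mxnorm2 Qk <= 2 ->
  mxnorm2 (Qp^T *m W) <= f -> mxnorm2 (Qp^T *m Qk) <= 2 * f / tau.
Proof.
move=> WE tau0 gain Qk2 Hf.
have f0 : 0 <= f := le_trans (mxnorm2_ge0 _) Hf.
have gainT : lower_gain Tkk (tau / 2).
  move=> x; rewrite mulrAC ler_pdivrMr// [leRHS]mulrC (le_trans (gain x))//.
  rewrite WE -mulmxA (le_trans (ler_vnorm2_mulmx _ _))//.
  by rewrite ler_wpM2r ?vnorm2_ge0.
have Tunit := lower_gain_unitmx (divr_gt0 tau0 (ltr0n _ 2)) gainT.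
apply: mxnorm2_le => [|y]; first by rewrite !mulr_ge0// invr_ge0 ltW.
pose x := invmx Tkk *m y.
have yE : y = Tkk *m x by rewrite /x mulmxA mulmxV// mul1mx.
rewrite {1}yE mulmxA -(mulmxA _ Qk) -WE (le_trans (ler_vnorm2_mulmx _ _))//.
have := gainT x; rewrite -yE => xy.
have {}xy : vnorm2 x <= 2 / tau * vnorm2 y.
  by rewrite -ler_pdivrMl ?divr_gt0// invf_div.
rewrite (@le_trans _ _ (f * (2 / tau * vnorm2 y)))//.
  by rewrite ler_pM ?mxnorm2_ge0 ?vnorm2_ge0.
by rewrite le_eqVlt; apply/orP; left; apply/eqP; ring.
Qed.

Lemma mxnorm2_mul_prefix_projS s p m (A : 'M[R]_(m, \sum_(k < p) s)) (k : 'I_p)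
  :
  mxnorm2 (A *m prefix_proj R s p k.+1)
  <= mxnorm2 (A *m prefix_proj R s p k) + mxnorm2 (A *m block_sel R s k).
Proof.
rewrite prefix_projS mulmxDr (le_trans (ler_mxnorm2D _ _))// lerD2l mulmxA.
rewrite -[leRHS]mulr1 ler_mxnorm2M_bound// mxnorm2_tr.
exact/mxnorm2_isometry/block_sel_isometry.
Qed.

(** A 2 by 2 block splitting; the off-diagonal blocks are transposes of each other, whence the
    factor 2. *)
Lemma mxnorm2_prefix_projS s p (M : 'M[R]_(\sum_(k < p) s)) (k : 'I_p) :
  M^T = M ->
  mxnorm2 (prefix_proj R s p k.+1 *m M *m prefix_proj R s p k.+1)
  <= mxnorm2 (prefix_proj R s p k *m M *m prefix_proj R s p k)
   + 2 * mxnorm2 ((prefix_sel R s k)^T *m M *m block_sel R s k)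
   + mxnorm2 ((block_sel R s k)^T *m M *m block_sel R s k).
Proof.
move=> Msym; rewrite prefix_projS -prefix_sel_proj.
set E := prefix_sel R s k; set F := block_sel R s k.
have E1 : mxnorm2 E <= 1 by exact/mxnorm2_isometry/prefix_sel_isometry.
have F1 : mxnorm2 F <= 1 by exact/mxnorm2_isometry/block_sel_isometry.
have -> : (E *m E^T + F *m F^T) *m M *m (E *m E^T + F *m F^T)
    = E *m E^T *m M *m (E *m E^T) + E *m (E^T *m M *m F) *m F^T
    + F *m (E^T *m M *m F)^T *m E^T + F *m (F^T *m M *m F) *m F^T.
  rewrite !trmx_mul trmxK Msym !(mulmxDl, mulmxDr) !mulmxA !addrA.
  by apply/matrixP => i j; rewrite ![in LHS]mxE ![in RHS]mxE; ring.
have sandwich q1 q2 n1 n2 (A : 'M[R]_(q1, n1)) (B : 'M[R]_(n1, n2))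
    (C : 'M[R]_(q2, n2)) : mxnorm2 A <= 1 -> mxnorm2 C <= 1 ->
    mxnorm2 (A *m B *m C^T) <= mxnorm2 B.
  move=> A1 C1; rewrite -[leRHS]mulr1 -[mxnorm2 B]mul1r.
  by rewrite !ler_mxnorm2M_bound// mxnorm2_tr.
rewrite (le_trans (ler_mxnorm2D _ _))//.
have := sandwich _ _ _ _ E (E^T *m M *m F) F E1 F1.
have := sandwich _ _ _ _ F (F^T *m M *m F) F F1 F1.
have := sandwich _ _ _ _ F (E^T *m M *m F)^T E F1 E1; rewrite mxnorm2_tr.
have := ler_mxnorm2D (E *m E^T *m M *m (E *m E^T)) (E *m (E^T *m M *m F) *m
  F^T).
have := ler_mxnorm2D (E *m E^T *m M *m (E *m E^T) + E *m (E^T *m M *m F) *m F^T)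
  (F *m (E^T *m M *m F)^T *m E^T).
by clear; lra.
Qed.

End StepEstimates.

(** * The induction invariant and its base, the first block *)

Section BlockSteps.
Variable R : realType.

Lemma lower_gain_weaken m n (A : 'M[R]_(m, n)) sigma tau :
  tau <= sigma -> lower_gain A sigma -> lower_gain A tau.
Proof.
by move=> ts gain x; rewrite (le_trans _ (gain x))// ler_wpM2r ?vnorm2_ge0.
Qed.

(** Moves the accuracy assumption from extended reals to reals, with [K] in place of the actual
    condition number. Absolute values appear because the signs of [c1] and [c2] are arbitrary. *)
Lemma io_accurate_bounds m s (u c1 c2 alpha K sigma : R) (IO : io_routine R m s)
    (X Q : 'M[R]_(m, s)) T : (0 < s)%N -> 0 <= u -> 0 <= alpha ->
  io_accurate u c1 c2 alpha K%:E IO -> io_fl IO X = (Q, T) ->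
  0 < sigma -> lower_gain X sigma -> mxnorm2 X <= K * sigma ->
  mxnorm2 (Q *m T - X) <= `|c1| * u * mxnorm2 X /\
  mxnorm2 (Q^T *m Q - 1%:M) <= `|c2| * u * K `^ alpha.
Proof.
move=> s0 u0 a0 acc XQT sigma0 gain XK.
have condK := cond2_le s0 sigma0 gain XK.
have := acc X condK; rewrite XQT => -[[DX <- DXle] orth].
have [tau [tau0 _ condE]] := cond2_lty s0 (le_lt_trans condK (ltry _)).
split.
  rewrite addrC addKr (le_trans DXle)// ler_wpM2r ?mxnorm2_ge0//.
  by rewrite ler_wpM2r// ler_norm.
rewrite mxnorm2_subC; move: orth condK;
  rewrite condE poweR_EFin -EFinM !lee_fin.
set r := mxnorm2 X / tau => orth rK.
have r0 : 0 <= r by rewrite divr_ge0 ?mxnorm2_ge0// ltW.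
rewrite (le_trans orth)//.
have rKa : r `^ alpha <= K `^ alpha.
  by apply: ge0_ler_powR => //; rewrite ?nnegrE// (le_trans r0).
rewrite (@le_trans _ _ (`|c2| * u * r `^ alpha))//.
  by rewrite ler_wpM2r ?powR_ge0// ler_wpM2r// ler_norm.
by rewrite ler_wpM2l// mulr_ge0.
Qed.

(** The invariant of the induction on blocks; [beta] will be [kappa^max(alpha, 1)]. *)
Definition prefix_bounds m s p (u beta D : R) (X Q : 'M[R]_(m, \sum_(k < p) s))
    (T : 'M[R]_(\sum_(k < p) s)) (k : nat) : Prop :=
  mxnorm2 ((Q *m T - X) *m prefix_proj R s p k) <= D * u * mxnorm2 X /\
  mxnorm2 (prefix_proj R s p k *m (Q^T *m Q - 1%:M) *m prefix_proj R s p k)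
    <= D * u * beta.

Lemma gram_sub1_sym m n (Q : 'M[R]_(m, n)) :
  (Q^T *m Q - 1%:M)^T = Q^T *m Q - 1%:M.
Proof. by rewrite linearB /= trmx_mul trmxK trmx1. Qed.

Lemma first_block_bounds m s p (u cA1 cA2 alphaA kappa sigma beta : R)
    (IOA : io_routine R m s) (X Q : 'M[R]_(m, \sum_(k < p) s)) T (k : 'I_p) :
  (0 < s)%N -> 0 <= u -> 0 <= alphaA -> k = 0%N :> nat ->
  (forall i j : 'I_p, (j < i)%N -> submxblock T i j = 0) ->
  io_fl IOA (submxrow X k) = (submxrow Q k, submxblock T k k) ->
  io_accurate u cA1 cA2 alphaA kappa%:E IOA ->
  0 < sigma -> lower_gain X sigma -> mxnorm2 X = kappa * sigma ->
  0 <= beta -> kappa `^ alphaA <= beta ->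
  prefix_bounds u beta (`|cA1| + `|cA2|) X Q T k.+1.
Proof.
move=> s0 u0 a0 k0 Tup ioE acc sigma0 gain XE beta0 kbeta.
set F := block_sel R s k.
have F1 : F^T *m F = 1%:M := block_sel_isometry R s k.
have P0 : prefix_proj R s p k = 0 by rewrite k0 prefix_proj0.
have EE0 : prefix_sel R s k *m (prefix_sel R s k)^T = 0.
  by rewrite prefix_sel_proj.
have XF_le := mxnorm2_mul_isometry X F1.
move: ioE; rewrite -!mul_block_sel -/F => ioE.
have [|resid orth] := io_accurate_bounds s0 u0 a0 acc ioE sigma0
  (lower_gain_isometry F1 gain); first by rewrite -XE.
split.
  rewrite (le_trans (mxnorm2_mul_prefix_projS _ _))// P0.
  rewrite mulmx0 mxnorm2_0 add0r -/F.
  have -> : (Q *m T - X) *m F = Q *m F *m submxblock T k k - X *m F.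
    have TF : T *m F = F *m submxblock T k k.
      by rewrite (block_upper_mul_block_sel Tup) mulmxA EE0 mul0mx add0r.
    by rewrite mulmxBl -[in LHS]mulmxA TF mulmxA.
  rewrite (le_trans resid)// ler_pM ?mulr_ge0 ?mxnorm2_ge0//.
  by rewrite ler_wpM2r// lerDl.
rewrite (le_trans (mxnorm2_prefix_projS _ (gram_sub1_sym _)))//.
rewrite P0 !mul0mx mxnorm2_0 add0r.
(* [k] is 0 only by a hypothesis, so the columnless selection [E] is shown to vanish through
   [E^T = E^T E E^T]. *)
have -> : (prefix_sel R s k)^T = 0.
  by rewrite -[LHS]mul1mx -(prefix_sel_isometry R s k) -mulmxA EE0 mulmx0.
rewrite !mul0mx mxnorm2_0 mulr0 add0r -/F.
have -> : F^T *m (Q^T *m Q - 1%:M) *m F = (Q *m F)^T *m (Q *m F) - 1%:M.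
  by rewrite trmx_mul mulmxBr mulmxBl mulmx1 F1 !mulmxA.
rewrite (le_trans orth)// ler_pM ?mulr_ge0 ?powR_ge0//.
by rewrite ler_wpM2r// lerDr.
Qed.

End BlockSteps.

(** * The induction step for a later block *)

Section NextBlock.
Variable R : realType.

(* All products below are compared with x = u kappa beta, and u, u kappa and
   u beta are at most x. *)
Lemma next_block_smallness (u kappa beta D b c1 c2 K C : R) :
  0 < u -> 1 <= kappa -> 1 <= beta -> 0 <= D -> 0 <= b -> 0 <= c1 -> 0 <= c2 ->
  K = 1 + D + b + c1 + c2 -> 8 * K <= C -> C * u * (kappa * beta) <= 2^-1 ->
  [/\ u <= 1 / 16, D * u * beta <= 1 / 16, D * u * beta * kappa <= 1 / 16,
      D * (u * kappa) <= 1 / 16 &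
      [/\ b * (u * kappa) <= 1 / 16, c1 * (u * kappa) <= 1 / 16,
          c2 * u * beta <= 1 / 16, C * (u * kappa) <= 1 / 2 & K * (u * kappa) <= 1 / 16]].
Proof.
move=> u0 k1 b1 D0 b0 c10 c20 KE KC Cx; pose x := u * kappa * beta.
have uk0 : 0 < u * kappa by rewrite mulr_gt0// (lt_le_trans ltr01).
have ub0 : 0 < u * beta by rewrite mulr_gt0// (lt_le_trans ltr01).
have x0 : 0 < x by rewrite mulr_gt0// (lt_le_trans ltr01).
have ukx : u * kappa <= x by rewrite ler_peMr// ltW.
have ubx : u * beta <= x by rewrite /x mulrAC ler_peMr// ltW.
have ux : u <= x by rewrite (le_trans _ ukx)// ler_peMr// ltW.
have K1 : 1 <= K by rewrite KE; lra.
have Kx : K * x <= 1 / 16.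
  have : 8 * K * x <= C * x by rewrite ler_wpM2r// ltW.
  have -> : C * x = C * u * (kappa * beta) by rewrite /x; ring.
  by move: Cx; clear; lra.
have small a y : 0 <= a -> a <= K -> 0 <= y -> y <= x -> a * y <= 1 / 16.
  by move=> a0 aK y0 yx; rewrite (le_trans _ Kx)// ler_pM.
have DK : D <= K by rewrite KE; lra.
have bK : b <= K by rewrite KE; lra.
have c1K : c1 <= K by rewrite KE; lra.
have c2K : c2 <= K by rewrite KE; lra.
have C0 : 0 <= C by rewrite (le_trans _ KC)// mulr_ge0// (le_trans ler01).
split; [|rewrite -mulrA|..].
- by rewrite -[leLHS]mul1r small// ltW.
- by rewrite small// ltW.
- have -> : D * u * beta * kappa = D * x by rewrite /x; ring.
  by rewrite small// ltW.
- by rewrite small// ltW.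
split; [| |rewrite -mulrA|..].
- by rewrite small// ltW.
- by rewrite small// ltW.
- by rewrite small// ltW.
- rewrite (@le_trans _ _ (C * x))//; first by rewrite ler_wpM2l.
  by rewrite div1r (le_trans _ Cx)// /x !mulrA.
- by rewrite small// ?(le_trans ler01 K1)// ltW.
Qed.

(** [C'] is left free above [C] because the final constant, shared by the smallness condition and
    the accuracy range, is known only once all blocks are treated. *)
Lemma next_block_bounds m s p (alpha c1 c2 D : R) (k : 'I_p) :
  (0 < s)%N -> (p * s <= m)%N -> 0 <= alpha -> 0 <= D ->
  exists C D' : R, 0 <= D' /\
  forall u C' kappa sigma beta (IOA IO : io_routine R m s)
    (X Q : 'M[R]_(m, \sum_(k < p) s)) T,
  C <= C' -> 0 < u -> 1 <= kappa -> kappa <= beta -> kappa `^ alpha <= beta ->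
  C' * u * (kappa * beta) <= 2^-1 -> (0 < k)%N -> bcgsi_a3s u IOA IO X Q T ->
  io_accurate u c1 c2 alpha ((1 + C' * u * kappa) * kappa)%:E IO ->
  0 < sigma -> lower_gain X sigma -> mxnorm2 X = kappa * sigma ->
  prefix_bounds u beta D X Q T k -> prefix_bounds u beta D' X Q T k.+1.
Proof.
move=> s0 psm a0 D0; have [b b0 reorth] := reorthogonalization R m.
(* The power of 2 arises because the range for [W] is [(1 + C u kappa) kappa <= 2 kappa]. *)
pose d1 := `|c1|; pose d2 := `|c2| * 2 `^ alpha; pose K := 1 + D + b + d1 + d2.
have d10 : 0 <= d1 by exact: normr_ge0.
have d20 : 0 <= d2 by rewrite mulr_ge0 ?powR_ge0.
have bD0 : 0 <= b * D by rewrite mulr_ge0.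
have DbK : D + b <= K by rewrite /K; move: d10 d20; clear; lra.
have K0 : 0 <= K by rewrite (le_trans _ DbK)// addr_ge0.
(* [D'] adds up two needs: orthogonality takes [D], twice the cross bound [4 b D + 4 b + 16 d1], and
   [d2]; the residual contributes [b + 2 d1]. *)
exists (8 * K), (D + 8 * (b * D) + 9 * b + 34 * d1 + d2).
split; first by move: D0 bD0 b0 d10 d20; clearbody d1 d2; clear; lra.
move=> u C kappa sigma beta IOA IO X Q T KC u0 k1 kb kab Cx k0.
move=> [_ /(_ k k0) step Tup] acc sigma0 gain XE [resid orth].
have b1 : 1 <= beta := le_trans k1 kb.
have [u16 delta16 deltak Duk [buk cuk dub Cuk Kuk]] :=
  next_block_smallness u0 k1 b1 D0 b0 d10 d20 (erefl K) KC Cx.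
have k_ge0 : 0 <= kappa := le_trans ler01 k1.
have uk0 : 0 <= u * kappa by rewrite mulr_ge0// ltW.
have u_uk : u <= u * kappa by rewrite ler_peMr// ltW.
set E := prefix_sel R s k; set F := block_sel R s k.
have F1 : F^T *m F = 1%:M := block_sel_isometry R s k.
have E1 : E^T *m E = 1%:M := prefix_sel_isometry R s k.
have EF : E^T *m F = 0 := prefix_sel_orth R s k.
set C0 := E^T *m (T *m F).
move: step; rewrite /= -mul_prefix_sel -prefix_sel_mul -!mul_block_sel -/E -/F
  -/C0.
move=> [S [Y [QS [V [QY [W [SE [QSE VE] YE [QYE WE] [ioE CE]]]]]]]].
set delta := D * u * beta.
have orthE : mxnorm2 ((Q *m E)^T *m (Q *m E) - 1%:M) <= delta.
  have -> : (Q *m E)^T *m (Q *m E) - 1%:M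
      = E^T *m (prefix_proj R s p k *m (Q^T *m Q - 1%:M)
                *m prefix_proj R s p k) *m E.
    rewrite -prefix_sel_proj -/E !mulmxA E1 mul1mx -!mulmxA E1 mulmx1.
    by rewrite mulmxBl mul1mx mulmxBr E1 trmx_mul !mulmxA.
  rewrite (le_trans (mxnorm2_mul_isometry _ E1))//.
  rewrite (le_trans _ orth)// -[leRHS]mul1r ler_mxnorm2M_bound// mxnorm2_tr.
  exact: mxnorm2_isometry.
have u1 : u <= 1 by move: u16; clear; lra.
have delta1 : delta <= 1 by rewrite (le_trans delta16)//; clear; lra.
have km : (\sum_(j < k) s <= m)%N.
  by rewrite sum_nat_const card_ord (leq_trans _ psm)// leq_mul2r ltnW ?orbT.
have sm : (s <= m)%N.
  by rewrite (leq_trans _ psm)// leq_pmull// (leq_ltn_trans (leq0n k)).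
have [W_le W_res W_orth] := reorth _ _ _ _ _ _ _ _ _ _ _ _ _ _ (leqnn m) km sm
  (ltW u0) u1 orthE delta1 SE QSE VE YE QYE WE CE.
have XF_le : mxnorm2 (X *m F) <= kappa * sigma.
  by rewrite -XE mxnorm2_mul_isometry.
have ks0 : 0 <= kappa * sigma by rewrite mulr_ge0// ltW.
have {}W_le : mxnorm2 W <= (1 + b * u) * (kappa * sigma).
  by rewrite (le_trans W_le)// ler_wpM2l// addr_ge0// mulr_ge0// ltW.
have {}W_res : mxnorm2 (W - (X *m F - Q *m E *m C0)) <= b * u * (kappa * sigma).
  by rewrite (le_trans W_res)// ler_wpM2l// mulr_ge0// ltW.
have {}W_orth :
    mxnorm2 ((Q *m E)^T *m W) <= b * (delta ^+ 2 + u) * (kappa * sigma).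
  by rewrite (le_trans W_orth)// ler_wpM2l// mulr_ge0// addr_ge0 ?sqr_ge0// ltW.
have bu_le : b * u <= b * (u * kappa) by rewrite ler_wpM2l.
rewrite XE in resid.
pose sigmaW := sigma - D * u * (kappa * sigma) - b * u * (kappa * sigma).
have sigmaWE : sigmaW = sigma * (1 - D * (u * kappa) - b * (u * kappa)).
  by rewrite /sigmaW; ring.
have sigmaW_ge : 7 / 8 * sigma <= sigmaW.
  rewrite sigmaWE mulrC ler_pM2l//; move: Duk buk; clear; lra.
have sigmaW0 : 0 < sigmaW.
  by rewrite (lt_le_trans _ sigmaW_ge)// mulr_gt0.
have e1_lt : D * u * (kappa * sigma) < sigma.
  have -> : D * u * (kappa * sigma) = D * (u * kappa) * sigma by ring.
  by rewrite gtr_pMl//; move: Duk; clear; lra.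
have gainW : lower_gain W sigmaW :=
  lower_gain_reorthogonalized Tup gain e1_lt resid W_res.
(* With [y = u kappa], the needed [1 + b y <= (1 + C y) (1 - D y - b y)] follows from [C >= 8 K]:
   the right side is at least [1 - K y + 7 K y]. *)
have W_cond : mxnorm2 W <= (1 + C * u * kappa) * kappa * sigmaW.
  rewrite (le_trans W_le)// sigmaWE.
  have -> : (1 + C * u * kappa) * kappa
      * (sigma * (1 - D * (u * kappa) - b * (u * kappa)))
    = (1 + C * (u * kappa)) * (1 - D * (u * kappa) - b * (u * kappa))
      * (kappa * sigma) by ring.
  rewrite ler_wpM2r//.
  set y := u * kappa in bu_le Duk buk Cuk Kuk uk0 *.
  have : C * y * (7 / 8) <= C * y * (1 - D * y - b * y).
    rewrite ler_wpM2l//; last by move: Duk buk; clear; lra.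
    by rewrite mulr_ge0// (le_trans _ KC)// mulr_ge0.
  have : 8 * K * y <= C * y by rewrite ler_wpM2r.
  have : (D + b) * y <= K * y.
    by rewrite ler_wpM2r.
  have : 0 <= b * y by rewrite mulr_ge0.
  have : 0 <= D * y by rewrite mulr_ge0.
  by move: bu_le; clear; lra.
have [residW orthQk] := io_accurate_bounds s0 (ltW u0) a0 acc ioE sigmaW0 gainW
  W_cond.
set Qk := Q *m F in ioE residW orthQk;
  set Tkk := submxblock T k k in ioE residW.
have {}W_le : mxnorm2 W <= 2 * (kappa * sigma).
  rewrite (le_trans W_le)// ler_wpM2r//; move: bu_le buk; clear; lra.
have {}residW : mxnorm2 (Qk *m Tkk - W) <= 2 * d1 * (u * kappa) * sigma.
  rewrite (le_trans residW)//.
  have -> : 2 * d1 * (u * kappa) * sigma = d1 * u * (2 * (kappa * sigma)).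
    by ring.
  by rewrite ler_wpM2l// mulr_ge0// ltW.
have {}orthQk : mxnorm2 (Qk^T *m Qk - 1%:M) <= d2 * u * beta.
  rewrite (le_trans orthQk)//.
  have -> : d2 * u * beta = `|c2| * u * (2 `^ alpha * beta).
    by rewrite /d2; ring.
  apply: ler_wpM2l; first by rewrite mulr_ge0// ltW.
  rewrite (@le_trans _ _ ((2 * kappa) `^ alpha))//.
    apply: ge0_ler_powR => //; rewrite ?nnegrE ?mulr_ge0//.
      rewrite addr_ge0// -mulrA mulr_ge0// (le_trans _ KC)//.
      by rewrite mulr_ge0.
    by rewrite ler_wpM2r// -mulrA; move: Cuk; clear; lra.
  by rewrite powRM// ler_wpM2l ?powR_ge0.
have Qk2 : mxnorm2 Qk <= 2.
  apply: mxnorm2_le_gram; rewrite (le_trans orthQk)// (le_trans dub)//.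
  by clear; lra.
have QE2 : mxnorm2 (Q *m E)^T <= 2.
  by rewrite mxnorm2_tr; apply: mxnorm2_le_gram; exact: le_trans delta1.
(* The factorization of [W] is inexact, so the gain is passed on to [Qk Tkk]: at least [7/8 - 1/8]
   of [sigma] remains. *)
have gainQT : lower_gain (Qk *m Tkk) (sigma / 2).
  rewrite -[Qk *m Tkk](subrK W) addrC.
  apply: lower_gain_weaken (lower_gainD gainW residW).
  have : d1 * (u * kappa) * sigma <= 1 / 16 * sigma by rewrite ler_pM2r.
  by move: sigmaW_ge sigma0; clear; lra.
have cross :
    mxnorm2 ((Q *m E)^T *m Qk) <= (4 * (b * D) + 4 * b + 16 * d1) * u * beta.
  pose f := (b * D + b + 4 * d1) * (u * beta) * sigma.
  have QW : mxnorm2 ((Q *m E)^T *m (Qk *m Tkk)) <= f.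
    rewrite -[Qk *m Tkk](subrK W) mulmxDr (le_trans (ler_mxnorm2D _ _))//.
    have := ler_mxnorm2M_bound QE2 residW.
    (* Here the product [u kappa beta] itself must be small; the other estimates need only [u kappa]
       and [u beta]. *)
    have deltak1 : delta * (delta * kappa) <= delta * 1.
      apply: ler_wpM2l; first exact: le_trans (mxnorm2_ge0 _) orthE.
      by apply: (le_trans deltak); clear; lra.
    have h1 :
        b * sigma * (delta * (delta * kappa)) <= b * D * (u * beta) * sigma.
      have -> : b * D * (u * beta) * sigma = b * sigma * (delta * 1).
        by rewrite /delta; ring.
      by rewrite ler_wpM2l// mulr_ge0// ltW.
    have ukub : u * kappa <= u * beta by rewrite ler_pM2l.
    have h2 : b * sigma * (u * kappa) <= b * sigma * (u * beta).
      by rewrite ler_wpM2l// mulr_ge0// ltW.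
    have h3 : d1 * sigma * (u * kappa) <= d1 * sigma * (u * beta).
      by rewrite ler_wpM2l// mulr_ge0// ltW.
    move: W_orth h1 h2 h3; rewrite /f; clearbody d1 delta.
    by clear; lra.
  have := cross_gram_le (erefl _) (divr_gt0 sigma0 (ltr0n _ 2)) gainQT Qk2 QW.
  move=> /le_trans; apply; rewrite ler_pdivrMr ?divr_gt0// /f.
  by rewrite le_eqVlt; apply/orP; left; apply/eqP; field.
have ub0 : 0 <= u * beta by rewrite mulr_ge0// ?ltW// (lt_le_trans _ b1).
split.
  rewrite (le_trans (mxnorm2_mul_prefix_projS _ _))// -/F XE.
  have -> : (Q *m T - X) *m F = (Qk *m Tkk - W) + (W - (X *m F - Q *m E *m C0)).
    rewrite mulmxBl -[Q *m T *m F]mulmxA (block_upper_mul_block_sel Tup k).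
    rewrite -/E -/F -/C0 mulmxDr !mulmxA -/Qk -/Tkk.
    by apply/matrixP => i j; rewrite ![in LHS]mxE ![in RHS]mxE; ring.
  have := ler_mxnorm2D (Qk *m Tkk - W) (W - (X *m F - Q *m E *m C0)).
  have uks : 0 <= u * (kappa * sigma) by rewrite mulr_ge0// ltW.
  have h1 : 0 <= b * (u * (kappa * sigma)) by rewrite mulr_ge0.
  have h2 : 0 <= b * D * (u * (kappa * sigma)) by rewrite mulr_ge0.
  have h3 : 0 <= d1 * (u * (kappa * sigma)) by rewrite mulr_ge0.
  have h4 : 0 <= d2 * (u * (kappa * sigma)) by rewrite mulr_ge0.
  by move: resid W_res residW h1 h2 h3 h4; clearbody d1 d2; clear; lra.
rewrite (le_trans (mxnorm2_prefix_projS _ (gram_sub1_sym _)))// -/E -/F.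
have -> : E^T *m (Q^T *m Q - 1%:M) *m F = (Q *m E)^T *m Qk.
  by rewrite trmx_mul mulmxBr mulmxBl mulmx1 EF subr0 !mulmxA.
have -> : F^T *m (Q^T *m Q - 1%:M) *m F = Qk^T *m Qk - 1%:M.
  by rewrite trmx_mul mulmxBr mulmxBl mulmx1 F1 !mulmxA.
have h1 : 0 <= b * (u * beta) by rewrite mulr_ge0.
have h3 : 0 <= d1 * (u * beta) by rewrite mulr_ge0.
by move: orth cross orthQk h1 h3; clearbody d1 d2; clear; lra.
Qed.

End NextBlock.

(** The induction runs outside the quantification over u and the matrices, so that the constants
    depend on the dimensions, the exponents and the constants of the routines only. *)
Lemma bcgsi_prefix_bounds (R : realType) m s p
    (alphaA alpha cA1 cA2 c1 c2 : R) k :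
  (0 < s)%N -> (p * s <= m)%N -> 0 <= alphaA -> alphaA <= alpha -> (k <= p)%N ->
  exists C D : R, [/\ 0 < C, 0 <= D &
  forall u C' kappa sigma beta (IOA IO : io_routine R m s)
    (X Q : 'M[R]_(m, \sum_(k < p) s)) T,
  C <= C' -> 0 < u -> 1 <= kappa -> kappa <= beta -> kappa `^ alpha <= beta ->
  C' * u * (kappa * beta) <= 2^-1 -> bcgsi_a3s u IOA IO X Q T ->
  io_accurate u cA1 cA2 alphaA kappa%:E IOA ->
  io_accurate u c1 c2 alpha ((1 + C' * u * kappa) * kappa)%:E IO ->
  0 < sigma -> lower_gain X sigma -> mxnorm2 X = kappa * sigma ->
  prefix_bounds u beta D X Q T k].
Proof.
move=> s0 psm aA0 aAa; elim: k => [_|k IH kp].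
  exists 1, 0; split => // u C' kappa sigma beta IOA IO X Q T *.
  by rewrite /prefix_bounds prefix_proj0 !mulmx0 !mxnorm2_0 !mul0r.
have [C [D [C0 D0 bounds]]] := IH (ltnW kp).
pose i : 'I_p := Ordinal kp.
have [k0|k_gt0] := posnP k.
  exists 1, (`|cA1| + `|cA2|); split => //.
  move=> u C' kappa sigma beta IOA IO X Q T _ u0 k1 kb kab _ [io1 _ Tup] accA _.
  move=> sigma0 gain XE.
  have beta1 : 1 <= beta := le_trans k1 kb.
  apply: (@first_block_bounds _ _ _ _ _ _ _ alphaA kappa sigma beta IOA X Q T
    i) => //.
  - exact: ltW.
  - exact: io1.
  - exact: le_trans beta1.
  (* The only use of [alphaA <= alpha] for the first block: its defect must also fit under
     [beta]. *)
  - by rewrite (le_trans _ kab)// ler_powR.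
have [E [D' [D'0 next]]] :=
  @next_block_bounds R m s p alpha c1 c2 D i s0 psm (le_trans aA0 aAa) D0.
exists (Num.max C E), D'; split => //; first by rewrite lt_max C0.
move=> u C' kappa sigma beta IOA IO X Q T; rewrite ge_max => /andP[CC' EC'].
move=> u0 k1 kb kab Cx run accA acc sigma0 gain XE.
apply: (next u C' kappa sigma beta IOA IO X Q T) => //.
exact: (bounds u C' kappa sigma beta IOA IO X Q T).
Qed.

Theorem theorem3 (R : realType) (m s p : nat) (alphaA alpha : R)
    (cA1 cA2 c1 c2 : R) :
  (0 < m)%N -> (0 < s)%N -> (0 < p)%N -> (p * s <= m)%N ->
  0 <= alphaA -> 0 <= alpha -> alphaA <= alpha ->
  exists C C1 C2 : R, [/\ 0 < C, 0 < C1, 0 < C2 &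
    forall (u : R) (IOA IO : io_routine R m s)
      (X Q : 'M[R]_(m, \sum_(k < p) s))
      (T : 'M[R]_(\sum_(k < p) s, \sum_(k < p) s)),
      0 < u ->
      bcgsi_a3s u IOA IO X Q T ->
      io_accurate u cA1 cA2 alphaA (cond2 X) IOA ->
      io_accurate u c1 c2 alpha
        ((1 + (C * u)%:E * cond2 X) * cond2 X)%E IO ->
      ((C * u)%:E * cond2 X `^ (Num.max (alpha + 1) 2)%R <= (2^-1)%:E)%E ->
      (exists2 DX : 'M[R]_(m, \sum_(k < p) s),
         X + DX = Q *m T & mxnorm2 DX <= C1 * u * mxnorm2 X) /\
      ((mxnorm2 (1%:M - Q^T *m Q))%:E
         <= (C2 * u)%:E * cond2 X `^ (Num.max alpha 1)%R)%E].
Proof.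
move=> m0 s0 p0 psm aA0 a0 aAa.
have [C [D [C0 D0 bounds]]] :=
  bcgsi_prefix_bounds cA1 cA2 c1 c2 s0 psm aA0 aAa (leqnn p).
(* [D] may be 0, while positive constants are required. *)
have D10 : 0 < D + 1 by rewrite ltr_wpDl.
exists C, (D + 1), (D + 1); split => // u IOA IO X Q T u0 run accA acc condX.
have n0 : (0 < \sum_(k < p) s)%N by rewrite sum_nat_const card_ord muln_gt0 p0.
(* Rank deficiency is excluded: the exponent is at least 2, so an infinite condition number would
   make the left side of the smallness condition infinite. *)
have cond_fin : (cond2 X < +oo)%E.
  rewrite ltey; apply: contraPneq condX => ->; rewrite poweRyr.
    by rewrite gt0_muley// lte_fin mulr_gt0.
  by rewrite gt_eqF// lt_max ltr0n orbT.
have [sigma [sigma0 gain condE]] := cond2_lty n0 cond_fin.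
rewrite condE in accA acc condX *;
  set kappa := mxnorm2 X / sigma in accA acc condX *.
have XE : mxnorm2 X = kappa * sigma by rewrite divfK// gt_eqF.
have k1 : 1 <= kappa by rewrite ler_pdivlMr// mul1r lower_gain_le_mxnorm2.
have k0 : 0 < kappa := lt_le_trans ltr01 k1.
pose beta := kappa `^ Num.max alpha 1.
(* theta is [max(alpha, 1) + 1]. *)
have kbeta : kappa `^ Num.max (alpha + 1) 2 = kappa * beta.
  have -> : 2 = 1 + 1 :> R by ring.
  rewrite -addr_maxl powRD; last by rewrite (gt_eqF k0) implybT.
  by rewrite powRr1 ?ltW// mulrC.
have KE : ((1 + (C * u)%:E * kappa%:E) * kappa%:E)%E
  = ((1 + C * u * kappa) * kappa)%:E by [].
rewrite KE in acc; move: condX.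
rewrite !poweR_EFin kbeta -!EFinM !lee_fin => condX.
have [||resid orth] := bounds u C kappa sigma beta IOA IO X Q T (lexx C) u0 k1
  _ _ condX run accA acc sigma0 gain XE.
- by rewrite /beta le1r_powR// le_max lexx orbT.
- by rewrite /beta ler_powR// le_max lexx.
move: resid orth; rewrite prefix_proj_full !mulmx1 mul1mx => resid orth.
split.
  exists (Q *m T - X); first by rewrite addrC subrK.
  by rewrite (le_trans resid)// ler_wpM2r ?mxnorm2_ge0// ler_wpM2r ?ltW// ltrDl.
rewrite mxnorm2_subC (le_trans orth)// ler_wpM2r ?powR_ge0//.
by rewrite ler_wpM2r ?ltW// ltrDl.
Qed.
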